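(* Let $A\subseteq\mathbb{R}$ and $I\subseteq[1,2]$ be compact intervals, and let $g:A\times I\to\mathbb{R}$ be nondegenerate away from the origin and satisfy the cinematic curvature condition with constant $\kappa$. For $a\in A$ let $\Gamma_a=\{(X,g(a,|X|))\in\mathbb{R}^2\times\mathbb{R}:|X|\in I'\}$, where $I'$ is the compact interval with the same right endpoint as $I$ and length $|I|/2$. (a) If $g$ is elliptic, then there is a constant $C$ depending only on $|I|$, $\|g\|_{\mathrm{reg}}$, $\inf_{A\times I}|g_t|$, $\lambda_1$ and $\kappa$ such that for all $a,\bar a\in A$, $$\sup_{\tau\in\mathbb{R}^3}\big|(\Gamma_a(\delta)+\tau)\cap\Gamma_{\bar a}(\delta)\big|\le C\,\frac{\delta^2}{\delta+|\bar a-a|}\qquad\text{for all }\delta\in(0,1).$$ (b) If $g$ is hyperbolic, and if (i) $(g_{tta},g_{ttt})$ exists everywhere on $A\times I$ and (ii) the family of maps $\{t\mapsto(g_{tta}(a,t),g_{ttt}(a,t))\}_{a\in A}$ is equicontinuous, then there is a constant $C$ depending only on $|I|$, $\|g\|_{\mathrm{reg}}$, $\inf_{A\times I}|g_t|$, $\lambda_1$, $\kappa$ and the uniform modulus of continuity of $t\mapsto(g_{tta},g_{ttt})$ such that for all $a,\bar a\in A$, $$\sup_{\tau\in\mathbb{R}^3}\big|(\Gamma_a(\delta)+\tau)\cap\Gamma_{\bar a}(\delta)\big|\le C\,\frac{\delta^2|\log\delta|}{\delta+|\bar a-a|}\qquad\text{for all }\delta\in(0,1/2).$$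
   Context: Subscripts denote partial derivatives of $g(a,t)$. For a function $g$ on $A\times I$ put $\|g\|_\infty=\sup_{A\times I}|g|$, $\|g\|_{\mathrm{Lip}}=\sup_{(\bar a,\bar t)\neq(a,t)\in A\times I}\frac{|g(\bar a,\bar t)-g(a,t)|}{|\bar a-a|+|\bar t-t|}$, and $\|g\|_{\mathrm{reg}}=\|g_t\|_\infty+\|g_t\|_{\mathrm{Lip}}+\|g_{tt}\|_{\mathrm{Lip}}$ (finiteness includes the existence of $g_t,g_{tt}$ on $A\times I$). Given compact intervals $A\subseteq\mathbb{R}$, $I\subseteq[1,2]$, $g:A\times I\to\mathbb{R}$ is nondegenerate away from the origin if (a) $\|g\|_{\mathrm{reg}}<\infty$; and (b) $g_t(a,t)\ne0$ for all $(a,t)\in A\times I$ and $\lambda_1:=\inf_{t\in I}\inf_{\bar a\ne a\in A}\frac{|g_t(\bar a,t)-g_t(a,t)|}{|\bar a-a|}>0$. A function $g:A\times I\to\mathbb{R}$ with $\|g\|_{\mathrm{reg}}<\infty$ satisfies the cinematic curvature condition if $$\kappa:=\inf_{(\bar a,\bar t)\ne(a,t)\in A\times I}\frac{|g_t(\bar a,\bar t)-g_t(a,t)|+|g_{tt}(\bar a,\bar t)-g_{tt}(a,t)|}{|\bar a-a|+|\bar t-t|}>0;$$ furthermore it is called elliptic (resp. hyperbolic) if for all $\bar a\neq a$ in $A$ and $\bar t>t$ in $I$, $$D\cdot\big(g_t(\bar a,t)-g_t(a,t)\big)\cdot g_t(a,t)>0\ (\text{resp. }<0),$$ where $$D=\det\begin{pmatrix}g_t(\bar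 a,\bar t)-g_t(\bar a,t)&g_t(\bar a,t)-g_t(a,t)\\ g_{tt}(\bar a,\bar t)-g_{tt}(\bar a,t)&g_{tt}(\bar a,t)-g_{tt}(a,t)\end{pmatrix}.$$ For $E\subseteq\mathbb{R}^3$, $E(\delta)=\{x+y:x\in E,\ |y|<\delta\}$ and $|E|$ denotes Lebesgue measure; $|I|$ is the length of $I$. *)

(* Defs.v *)
From HB Require Import structures.
From mathcomp Require Import all_boot all_order all_algebra.
From mathcomp Require Import all_classical all_reals all_analysis.
Set Implicit Arguments.
Unset Strict Implicit.
Unset Printing Implicit Defensive.
Import Order.TTheory GRing.Theory Num.Theory.
Import numFieldNormedType.Exports.
Local Open Scope classical_set_scope.
Local Open Scope ring_scope.

Section Calculus.
Context {R : realType}.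
Implicit Types (A I D : set R) (g f : R -> R -> R).

(* A function on A x I is a total map R -> R -> R; every notion below looks   *)
(* only at its values on A x I. In particular derivatives are taken relative  *)
(* to the domain D, hence one-sided at the endpoints of an interval.          *)
Definition diff_quot (h : R -> R) (x : R) : R -> R :=
  fun y => (h y - h x) / (y - x).

Definition derivable_in D (h : R -> R) (x : R) : Prop :=
  cvg (diff_quot h x y @[y --> within D x^']).

Definition derive_in D (h : R -> R) (x : R) : R :=
  lim (diff_quot h x y @[y --> within D x^']).

Definition dt I g : R -> R -> R := fun a t => derive_in I (g a) t.
Definition da A g : R -> R -> R := fun a t => derive_in A (g ^~ t) a.

Definition has_dt A I g : Prop :=
  forall a t, A a -> I t -> derivable_in I (g a) t.
Definition has_da A I g : Prop :=
  forall a t, A a -> I t -> derivable_in A (g ^~ t) a.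

Definition distinct_pairs A I : set ((R * R) * (R * R)) :=
  [set pq | [/\ (A `*` I) pq.1, (A `*` I) pq.2 & pq.1 <> pq.2]].

Definition dist1 (p q : R * R) : R := `|p.1 - q.1| + `|p.2 - q.2|.

Definition sup_norm A I f : \bar R :=
  ereal_sup [set `|f p.1 p.2|%:E | p in A `*` I].

Definition Lip_norm A I f : \bar R :=
  ereal_sup [set (`|f pq.1.1 pq.1.2 - f pq.2.1 pq.2.2| / dist1 pq.1 pq.2)%:E
            | pq in distinct_pairs A I].

Definition reg_norm A I g : \bar R :=
  (sup_norm A I (dt I g) + Lip_norm A I (dt I g)
   + Lip_norm A I (dt I (dt I g)))%E.

Definition reg_finite A I g : Prop :=
  [/\ has_dt A I g, has_dt A I (dt I g) & (reg_norm A I g < +oo)%E].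

Definition inf_abs A I f : \bar R :=
  ereal_inf [set `|f p.1 p.2|%:E | p in A `*` I].

Definition lambda1 A I g : \bar R :=
  ereal_inf [set
    ereal_inf [set (`|dt I g p.1 t - dt I g p.2 t| / `|p.1 - p.2|)%:E
              | p in [set p : R * R | [/\ A p.1, A p.2 & p.1 <> p.2]]]
  | t in I].

Definition nondegenerate_away A I g : Prop :=
  [/\ reg_finite A I g,
      (forall a t, A a -> I t -> dt I g a t <> 0)
    & (0 < lambda1 A I g)%E].

Definition kappa A I g : \bar R :=
  ereal_inf [set
    ((`|dt I g pq.1.1 pq.1.2 - dt I g pq.2.1 pq.2.2|
      + `|dt I (dt I g) pq.1.1 pq.1.2 - dt I (dt I g) pq.2.1 pq.2.2|)
     / dist1 pq.1 pq.2)%:E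
  | pq in distinct_pairs A I].

Definition cinematic A I g : Prop :=
  reg_finite A I g /\ (0 < kappa A I g)%E.

Definition cinematic_det I g (a a' t t' : R) : R :=
  let gt := dt I g in
  let gtt := dt I (dt I g) in
  \det (\matrix_(i < 2, j < 2)
    if i == 0 then if j == 0 then gt a' t' - gt a' t else gt a' t - gt a t
    else if j == 0 then gtt a' t' - gtt a' t else gtt a' t - gtt a t).

Definition elliptic A I g : Prop :=
  forall a a' t t', A a -> A a' -> I t -> I t' -> a' <> a -> t < t' ->
    0 < cinematic_det I g a a' t t' * (dt I g a' t - dt I g a t) * dt I g a t.

Definition hyperbolic A I g : Prop :=
  forall a a' t t', A a -> A a' -> I t -> I t' -> a' <> a -> t < t' ->
    cinematic_det I g a a' t t' * (dt I g a' t - dt I g a t) * dt I g a t < 0.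

(* The norm of the library on a product is the sup norm; lengths in R^2 and   *)
(* R^3 are Euclidean.                                                         *)
Definition enorm2 (X : R * R) : R := Num.sqrt (X.1 ^+ 2 + X.2 ^+ 2).
Definition enorm3 (x : R * R * R) : R :=
  Num.sqrt (x.1.1 ^+ 2 + x.1.2 ^+ 2 + x.2 ^+ 2).

(* t |-> (g_tta(a,t), g_ttt(a,t)) *)
Definition third A I g (a t : R) : R * R :=
  (da A (dt I (dt I g)) a t, dt I (dt I (dt I g)) a t).

Definition has_third A I g : Prop :=
  has_da A I (dt I (dt I g)) /\ has_dt A I (dt I (dt I g)).

Definition third_equicontinuous A I g : Prop :=
  forall t, I t -> forall e : R, 0 < e -> exists2 h : R, 0 < h &
    forall s, I s -> `|s - t| < h ->
      forall a, A a -> enorm2 (third A I g a s - third A I g a t) < e.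

Definition third_modulus A I g (h : R) : \bar R :=
  ereal_sup [set (enorm2 (third A I g w.1 w.2.1 - third A I g w.1 w.2.2))%:E
            | w in [set w : R * (R * R) |
                [/\ A w.1, I w.2.1, I w.2.2 & `|w.2.1 - w.2.2| <= h]]].

Definition Gamma g (J : set R) (a : R) : set (R * R * R) :=
  [set (X, g a (enorm2 X)) | X in [set X : R * R | J (enorm2 X)]].

Definition thicken (E : set (R * R * R)) (d : R) : set (R * R * R) :=
  [set p.1 + p.2 | p in [set p : (R * R * R) * (R * R * R) |
                          E p.1 /\ enorm3 p.2 < d]].

Definition translate (E : set (R * R * R)) (tau : R * R * R) :
    set (R * R * R) :=
  [set x + tau | x in E].

Definition lebesgue3 : set (R * R * R) -> \bar R :=
  ((@lebesgue_measure R \x @lebesgue_measure R) \x @lebesgue_measure R)%E.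

Definition sup_overlap g (J : set R) (a a' d : R) : \bar R :=
  ereal_sup [set lebesgue3 (translate (thicken (Gamma g J a) d) tau
                            `&` thicken (Gamma g J a') d)
            | tau in [set: R * R * R]].

End Calculus.

(* Main.v *)
(* Slicing vertically, the overlap is O(d) times the area of the planar set     *)
(* where |F| <= O(d), F(X) = g(a', |X|) - g(a, |X - v|) - s, and tau = (v, s).   *)
(* Put M = |a' - a| + |v|. Both the gradient and the Hessian of F are O(M).      *)
(* Where |grad F| << M, the vectors X and X - v are almost parallel,             *)
(* | |X| - |X - v| | is comparable to M, and the Hessian is almost diagonal in   *)
(* the direction of X with entries                                               *)
(*   g_tt(a', |X|) - g_tt(a, |X - v|)   and   - g_t (|X| - |X - v|) / |X|^2,      *)
(* both of size M by the cinematic curvature condition, with equal signs in the  *)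
(* elliptic case and opposite signs in the hyperbolic one. Pairing grad F with   *)
(* Z, respectively with the reflection of Z across X, shows that F / M is        *)
(* uniformly convex (or concave), respectively that its gradient expands         *)
(* distances, on squares of a fixed size. A uniformly convex C^{1,1} function is  *)
(* O(eta) on a set of area O(eta); a C^{1,1} function with expanding gradient,   *)
(* on a set of area O(eta log(1/eta)). Areas are bounded by explicit finite      *)
(* covers by rectangles, so no measurability of the planar sets is needed.       *)
Require Import Defs.
From HB Require Import structures.
From mathcomp Require Import all_boot all_order all_algebra.
From mathcomp Require Import all_classical all_reals all_analysis.
From mathcomp Require Import measurable_realfun ring lra.
Set Implicit Arguments.
Unset Strict Implicit.
Unset Printing Implicit Defensive.
Import Order.TTheory GRing.Theory Num.Theory.
Import numFieldNormedType.Exports.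
Local Open Scope classical_set_scope.
Local Open Scope ring_scope.

(** The overlap has vertical thickness O(d), since [g] is Lipschitz in [t] ([slice]), so by
    [lebesgue3_le] its volume is O(d) times the area of its shadow. On the shadow [gap], the
    difference of the two radial profiles with one of them shifted by [v], lies within O(d) of a
    constant. The core is [planar_area]: this set has area O(d / |a' - a|), with one more logarithm
    in the hyperbolic case.

    Put M = |a' - a| + |v|. The Hessian of [gap] is O(M) ([hess_le]). If on a small square the
    gradient is comparable to M at some point, [gap] is almost affine there and the set is a strip
    of width O(d / M) ([area_cell]). Otherwise the gradient is small on the whole square. It is a
    difference of positive multiples of the directions of X and X - v, so the two values of g_t and
    the two directions almost agree. Since [lambda1] separates the values of g_t at equal radii, |
    |X| - |X - v| | must be comparable to M ([nearcrit_tau]). This makes the tangential eigenvalue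
    of the Hessian of size M. The radial eigenvalue is a difference of values of g_tt; as the values
    of g_t nearly agree, [kappa] makes it of size M, and the determinant condition fixes its sign
    ([det_sign], [nearcrit_sign]).

    In the elliptic case both eigenvalues have the same sign, and uniform convexity gives the area
    ([area_convex]). In the hyperbolic case [gap] is a saddle, but pairing the Hessian with a
    reflected vector ([hyperbolic_hess]) shows that the gradient expands distances; the region of
    small gradient then halves at each dyadic step, and about log(1/d) steps reach scale d
    ([area_log]). When |a' - a| is O(d), or d is comparable to the length of [I], the O(d) bound of
    [overlap_trivial] is enough ([large_or_small]). *)

(** * Finite covers by rectangles, and integrals of nonnegative functions *)

Section Covered.
Context {R : realType}.
Implicit Types (S T : set (R * R)) (b : (R * R) * (R * R)).

(* [b] is the pair (lower left corner, side lengths). *)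
Definition box b : set (R * R) :=
  [set X | b.1.1 <= X.1 <= b.1.1 + b.2.1 /\ b.1.2 <= X.2 <= b.1.2 + b.2.2].

(** A bound on the outer Jordan content, so it passes to arbitrary subsets. *)
Definition covered S (m : R) : Prop :=
  exists s : seq ((R * R) * (R * R)),
    [/\ forall b, b \in s -> 0 <= b.2.1 /\ 0 <= b.2.2,
        forall X, S X -> exists2 b, b \in s & box b X
      & \sum_(b <- s) b.2.1 * b.2.2 <= m].

Lemma covered_sub S T m m' :
  S `<=` T -> m <= m' -> covered T m -> covered S m'.
Proof.
move=> ST mm' [s [s0 sT sm]]; exists s; split => //; last exact: le_trans mm'.
by move=> X /ST; exact: sT.
Qed.

Lemma covered_box S b : 0 <= b.2.1 -> 0 <= b.2.2 -> S `<=` box b ->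
  covered S (b.2.1 * b.2.2).
Proof.
move=> l0 h0 Sb; exists [:: b]; split.
- by move=> c; rewrite inE => /eqP ->.
- by move=> X SX; exists b; [rewrite inE | exact: Sb].
- by rewrite big_seq1.
Qed.

Lemma covered0 S m : 0 <= m -> (forall X, ~ S X) -> covered S m.
Proof. by move=> m0 S0; exists [::]; split => //; [move=> X /S0 | rewrite big_nil]. Qed.

Lemma coveredU S T m n : covered S m -> covered T n ->
  covered (S `|` T) (m + n).
Proof.
move=> [s [s0 sS sm]] [t [t0 tT tn]]; exists (s ++ t); split.
- by move=> b; rewrite mem_cat => /orP[/s0|/t0].
- move=> X [/sS[b bs bX]|/tT[b bt bX]]; exists b => //; rewrite mem_cat ?bs//.
  by rewrite bt orbT.
- by rewrite big_cat /=; exact: lerD.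
Qed.

Lemma covered_swap S m : covered [set X | S (X.2, X.1)] m -> covered S m.
Proof.
move=> [s [s0 sS sm]].
exists [seq ((b.1.2, b.1.1), (b.2.2, b.2.1)) | b <- s]; split.
- by move=> _ /mapP[b bs ->] /=; have [] := s0 _ bs.
- move=> [x y] SX; have [b bs [b1 b2]] := sS (y, x) SX.
  exists ((b.1.2, b.1.1), (b.2.2, b.2.1)); last by split.
  exact: (map_f (fun b : (R * R) * (R * R) => ((b.1.2, b.1.1), (b.2.2, b.2.1)))).
- by rewrite big_map; under eq_bigr => b _ do rewrite /= mulrC.
Qed.

Lemma covered_scale S m l : 0 < l -> covered S m ->
  covered [set X | S (l * X.1, l * X.2)] (m / l ^+ 2).
Proof.
move=> l0 [s [s0 sS sm]].
pose g b := ((l^-1 * b.1.1, l^-1 * b.1.2), (l^-1 * b.2.1, l^-1 * b.2.2)) : (R * R) * (R * R).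
exists [seq g b | b <- s]; split.
- move=> _ /mapP[b bs ->] /=; have [? ?] := s0 _ bs.
  by rewrite !mulr_ge0 // invr_ge0 ltW.
- move=> [x y] /= SX; have [b bs [/= b1 b2]] := sS _ SX.
  exists (g b); first exact: map_f.
  by split => /=; rewrite -mulrDr !(ler_pdivrMl _ _ l0, ler_pdivlMl _ _ l0).
- rewrite big_map ler_pdivlMr ?exprn_gt0// mulr_suml.
  rewrite (eq_bigr (fun b => b.2.1 * b.2.2))// => b _ /=.
  by field; rewrite gt_eqF.
Qed.

(** Induction on the number of columns, peeling off the rightmost one; [S] varies because what
    remains is a smaller set with the same column bound. *)
Lemma covered_columns S m d N x0 : 0 <= d ->
  (forall x, covered (S `&` [set X | x <= X.1 <= x + d]) m) ->
  (forall X, S X -> x0 <= X.1 <= x0 + N.+1%:R * d) ->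
  covered S (N.+1%:R * m).
Proof.
move=> d0 Sm; elim: N S Sm => [|N IH] S Sm Sx.
  apply: (covered_sub _ _ (Sm x0)); last by rewrite mul1r.
  by move=> X SX; split => //=; have := Sx X SX; rewrite mul1r.
pose x1 := x0 + N.+1%:R * d.
have c1 : covered (S `&` [set X | X.1 <= x1]) (N.+1%:R * m).
  apply: IH; last first.
    by move=> X [/Sx/andP[-> _]].
  move=> x; apply: (covered_sub _ _ (Sm x)) => //.
  by move=> X [[SX _] ?]; split.
apply: (covered_sub _ _ (coveredU c1 (Sm x1))).
  move=> X SX; have [h|h] := leP X.1 x1; [by left | right; split => //=].
  rewrite (ltW h)/=; have /andP[_] := Sx X SX.
  by rewrite /x1 -(natr1 N.+1) mulrDl mul1r addrA.
by rewrite -(natr1 N.+1) mulrDl mul1r.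
Qed.

Lemma covered_grid S m l k p : 0 <= l ->
  (forall q, covered (S `&` box (q, (l / k.+1%:R, l / k.+1%:R))) m) ->
  S `<=` box (p, (l, l)) -> covered S (k.+1%:R ^+ 2 * m).
Proof.
move=> l0 Sm Sp.
have d0 : 0 <= l / k.+1%:R by rewrite divr_ge0.
have dE : k.+1%:R * (l / k.+1%:R) = l by rewrite mulrC divfK// pnatr_eq0.
rewrite expr2 -mulrA; apply: (@covered_columns _ _ (l / k.+1%:R) k p.1) => // [x|X SX]; last first.
  by rewrite dE; have [] := Sp X SX.
apply: covered_swap; apply: (@covered_columns _ _ (l / k.+1%:R) k p.2) => // [y|X [SX _]]; last first.
  by rewrite dE; have [] := Sp _ SX.
apply: covered_swap; apply: (covered_sub _ _ (Sm (x, y))) => //.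
by move=> [x' y'] [[SX h1] h2].
Qed.

Lemma le_lebesgue_measure (A B : set R) : A `<=` B ->
  (lebesgue_measure A <= lebesgue_measure B)%E.
Proof. by move=> AB; apply: le_mu_ext. Qed.

(** The integral of a nonnegative function is a supremum over the simple functions below it, and a
    larger function has more of them. This applies to the lengths of the sections of an arbitrary
    set. *)
Lemma le_integral_nonneg d (T : measurableType d)
    (mu : {measure set T -> \bar R}) (f g : T -> \bar R) :
  (forall x, 0 <= f x)%E -> (forall x, f x <= g x)%E ->
  (\int[mu]_x f x <= \int[mu]_x g x)%E.
Proof.
move=> f0 fg; have g0 x : (0 <= g x)%E by exact: le_trans (fg x).
rewrite !ge0_integralE// !patch_setT.
apply: ub_ereal_sup => _ [h hf <-]; apply: ereal_sup_ubound.
by exists h => // x; exact: le_trans (fg x).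
Qed.

End Covered.

(** * From planar covers to volume *)

Section Lebesgue3.
Context {R : realType}.
Local Notation mu := (@lebesgue_measure R).

Lemma lebesgue_measure_segment (x l : R) : 0 <= l ->
  mu `[x, x + l]%classic = l%:E.
Proof.
rewrite lebesgue_measure_itv /= lte_fin ltrDl le_eqVlt => /orP[/eqP <-|->].
  by rewrite ltxx.
by rewrite -EFinB addrAC subrr add0r.
Qed.

Lemma covered_measure (S : set (R * R)) (m : R) : covered S m ->
  exists2 B : set (R * R), S `<=` B &
    measurable (B : set (measurableTypeR R * measurableTypeR R)) /\
    ((mu \x mu) B <= m%:E)%E.
Proof.
move=> [s [s0 sS sm]].
suff [B [sB mB Bm]] : exists B : set (R * R), [/\ forall b, b \in s -> box b `<=` B,
    measurable (B : set (measurableTypeR R * measurableTypeR R)) &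
    ((mu \x mu) B <= (\sum_(b <- s) b.2.1 * b.2.2)%:E)%E].
  exists B; first by move=> X /sS[b /sB]; exact.
  by split => //; apply: (le_trans Bm); rewrite lee_fin.
elim: s s0 {sS sm} => [|b s IH] s0.
  by exists set0; split => //; rewrite measure0 big_nil.
have [B [sB mB Bm]] : exists B : set (R * R), [/\ forall b, b \in s -> box b `<=` B,
    measurable (B : set (measurableTypeR R * measurableTypeR R)) &
    ((mu \x mu) B <= (\sum_(b <- s) b.2.1 * b.2.2)%:E)%E].
  by apply: IH => c cs; apply: s0; rewrite inE cs orbT.
have [l0 h0] := s0 b (mem_head _ _).
pose I1 := `[b.1.1, b.1.1 + b.2.1]%classic.
pose I2 := `[b.1.2, b.1.2 + b.2.2]%classic.
have boxE : box b = I1 `*` I2.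
  by apply/seteqP; split => -[x y]; rewrite /box /I1 /I2 /setX /= !in_itv.
have mbox : measurable (box b : set (measurableTypeR R * measurableTypeR R)).
  by rewrite boxE; apply: measurableX; exact: measurable_itv.
exists (box b `|` B); split.
- move=> c; rewrite inE => /orP[/eqP ->|/sB cB]; first by left.
  by move=> X /cB; right.
- exact: measurableU.
- apply: (le_trans (measureU2 _ mbox mB)) => /=.
  rewrite big_cons EFinD; apply: leeD => //.
  have -> : ((mu \x mu) (box b) = mu I1 * mu I2)%E.
    by rewrite boxE; apply: product_measure1E; exact: measurable_itv.
  by rewrite !lebesgue_measure_segment// -EFinM.
Qed.

Lemma lebesgue3_le (E : set (R * R * R)) (S : set (R * R)) (m h : R) :
  0 <= h -> covered S m -> (forall X z, E (X, z) -> S X) ->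
  (forall X z z', E (X, z) -> E (X, z') -> `|z' - z| <= h) ->
  (lebesgue3 E <= (2 * h * m)%:E)%E.
Proof.
move=> h0 /covered_measure[B SB [mB Bm]] ES Eh.
have slice X : (mu (xsection E X) <= (2 * h * \1_B X)%:E)%E.
  have [[z Ez]|nE] := pselect (exists z, E (X, z)); last first.
    rewrite (_ : xsection E X = set0) ?measure0 ?lee_fin ?mulr_ge0//.
    by apply/seteqP; split => // z; rewrite xsectionE /= => Ez; apply: nE; exists z.
  rewrite indicE mem_set ?mulr1; last by apply: SB; exact: ES Ez.
  apply: (@le_trans _ _ (mu `[z - h, z + h]%classic)).
    apply: le_lebesgue_measure => z'; rewrite xsectionE /= => Ez'.
    by rewrite in_itv /= -ler_distl; exact: Eh Ez Ez'.
  rewrite lebesgue_measure_itv /= lte_fin; case: ifPn => _.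
    by rewrite -EFinB lee_fin; lra.
  by rewrite lee_fin; lra.
(* By definition the product measure of any set is the integral of the lengths of its vertical
   sections. *)
have -> : lebesgue3 E = (\int[(mu \x mu)%E]_X mu (xsection E X))%E by [].
apply: (@le_trans _ _ (\int[(mu \x mu)%E]_X (2 * h * \1_B X)%:E)%E).
  by apply: le_integral_nonneg => // X; exact: measure_ge0.
under eq_integral do rewrite EFinM.
rewrite ge0_integralZl//=; last 2 first.
- by apply/measurable_EFinP; exact: measurable_indic.
- by rewrite lee_fin mulr_ge0.
rewrite integral_indic// setIT [leRHS]EFinM.
by apply: lee_wpmul2l => //; rewrite lee_fin mulr_ge0.
Qed.

End Lebesgue3.

(** * Euclidean geometry of the plane *)

Section Plane.
Context {R : realType}.
Implicit Types (X Y Z : R * R).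

Definition dot X Y : R := X.1 * Y.1 + X.2 * Y.2.
Definition sc (c : R) X : R * R := (c * X.1, c * X.2).

Lemma enorm2_ge0 X : 0 <= enorm2 X.
Proof. exact: sqrtr_ge0. Qed.

Lemma enorm2_sqr X : enorm2 X ^+ 2 = dot X X.
Proof. by rewrite sqr_sqrtr ?addr_ge0 ?sqr_ge0// /dot !expr2. Qed.

Lemma enorm2_le X c : 0 <= c -> dot X X <= c ^+ 2 -> enorm2 X <= c.
Proof. by move=> c0 h; rewrite -ler_sqr ?nnegrE ?enorm2_ge0// enorm2_sqr. Qed.

Lemma le_enorm2 X c : 0 <= c -> c ^+ 2 <= dot X X -> c <= enorm2 X.
Proof. by move=> c0 h; rewrite -ler_sqr ?nnegrE ?enorm2_ge0// enorm2_sqr. Qed.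

Lemma dot_le X Y : `|dot X Y| <= enorm2 X * enorm2 Y.
Proof.
rewrite -ler_sqr ?nnegrE ?mulr_ge0 ?enorm2_ge0//.
rewrite real_normK ?num_real// exprMn !enorm2_sqr /dot.
by have := sqr_ge0 (X.1 * Y.2 - X.2 * Y.1); nra.
Qed.

Lemma enorm2D X Y : enorm2 (X + Y) <= enorm2 X + enorm2 Y.
Proof.
apply: enorm2_le; first by rewrite addr_ge0 ?enorm2_ge0.
rewrite sqrrD !enorm2_sqr.
have /ler_normlP[_] := dot_le X Y; rewrite /dot /=; nra.
Qed.

Lemma enorm2N X : enorm2 (- X) = enorm2 X.
Proof. by rewrite /enorm2 /= !sqrrN. Qed.

Lemma enorm2B X Y : enorm2 (X - Y) = enorm2 (Y - X).
Proof. by rewrite -enorm2N opprB. Qed.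

Lemma enorm2_dist X Y : `|enorm2 X - enorm2 Y| <= enorm2 (X - Y).
Proof.
have h1 := enorm2D (X - Y) Y; have h2 := enorm2D (Y - X) X.
rewrite !subrK in h1 h2; rewrite ler_norml (enorm2B Y X) in h2 *.
by apply/andP; split; lra.
Qed.

Lemma enorm2_sc c X : enorm2 (sc c X) = `|c| * enorm2 X.
Proof. by rewrite /enorm2 /= !exprMn -mulrDr sqrtrM ?sqr_ge0// sqrtr_sqr. Qed.

Lemma le_enorm2_fst X : `|X.1| <= enorm2 X.
Proof.
by apply: le_enorm2; rewrite ?normr_ge0// real_normK ?num_real// /dot; nra.
Qed.

Lemma le_enorm2_snd X : `|X.2| <= enorm2 X.
Proof.
by apply: le_enorm2; rewrite ?normr_ge0// real_normK ?num_real// /dot; nra.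
Qed.

Lemma enorm2_le_sum X : enorm2 X <= `|X.1| + `|X.2|.
Proof.
apply: enorm2_le; rewrite ?addr_ge0// sqrrD !real_normK ?num_real//.
have := normr_ge0 X.1; have := normr_ge0 X.2; rewrite /dot; nra.
Qed.

Lemma box_diam p l X Y : box (p, (l, l)) X -> box (p, (l, l)) Y ->
  enorm2 (X - Y) <= 2 * l.
Proof.
move=> [/= /andP[? ?] /andP[? ?]] [/= /andP[? ?] /andP[? ?]].
apply: (le_trans (enorm2_le_sum _)) => /=.
have -> : 2 * l = l + l by lra.
by apply: lerD; rewrite ler_norml; apply/andP; split; lra.
Qed.

Lemma ball_box X Y c : enorm2 (Y - X) <= c ->
  box ((X.1 - c, X.2 - c), (2 * c, 2 * c)) Y.
Proof.
move=> h; have := le_trans (le_enorm2_fst _) h; have := le_trans (le_enorm2_snd _) h.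
rewrite !ler_norml /= => /andP[? ?] /andP[? ?].
by split; apply/andP; split => /=; lra.
Qed.

End Plane.

(** * Sublevel sets on a cell where the gradient is large *)

Section Area.
Context {R : realType}.
Implicit Types (S : set (R * R)) (f : R * R -> R) (G : R * R -> R * R).

(** [G] stands for the gradient of a C^{1,1} function; the condition involves only pairs of points
    of [S], so it restricts to any subset. *)
Definition quad_approx S f G (C : R) : Prop :=
  forall X Y, S X -> S Y ->
    `|f Y - f X - dot (G X) (Y - X)| <= C * enorm2 (Y - X) ^+ 2 /\
    enorm2 (G Y - G X) <= C * enorm2 (Y - X).

Lemma quad_approx_sub S T f G C : T `<=` S -> quad_approx S f G C ->
  quad_approx T f G C.
Proof. by move=> TS h X Y /TS SX /TS SY; exact: h. Qed.

(** On the cell [f] is almost affine with vertical slope at least [ga / 2], so above a narrow column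
    the condition |f| <= eta confines the height to an interval of length O(eta / ga). *)
Lemma area_cell_vertical S f G C eta ga l p q :
  0 < l -> 0 < eta -> 0 < ga -> 0 <= C -> 32 * C * l <= ga ->
  S `<=` box (q, (l, l)) -> S p -> ga / 2 <= `|(G p).2| ->
  quad_approx S f G C -> (forall X, S X -> `|f X| <= eta) ->
  covered S (32 * l * eta / ga).
Proof.
move=> l0 eta0 ga0 C0 Cl Sq Sp gap T Seta.
pose B := `|(G p).1|; have B0 : 0 <= B by exact: normr_ge0.
(* Columns so narrow that moving across one changes the affine part of [f] by at most [eta]. *)
pose N := Num.bound ((B + ga) * l / eta).
have N0 : 0 < N.+1%:R :> R by rewrite ltr0n.
pose d := l / N.+1%:R.
have d0 : 0 < d by rewrite divr_gt0.
have NdE : N.+1%:R * d = l by rewrite mulrC divfK// gt_eqF.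
have Bd : (B + ga) * d <= eta.
  rewrite /d mulrA ler_pdivrMr// -ler_pdivrMl// mulrC.
  have : (B + ga) * l / eta < N%:R.
    by apply: archi_boundP; rewrite divr_ge0 ?mulr_ge0 ?addr_ge0// ltW.
  by move/ltW/le_trans; apply; rewrite ler_nat.
have key X Y : S X -> S Y -> `|Y.1 - X.1| <= d -> `|Y.2 - X.2| <= 8 * eta / ga.
  move=> SX SY dx.
  have [T1 _] := T X Y SX SY; have [_ T2] := T p X Sp SX.
  have d1 := box_diam (Sq Y SY) (Sq X SX); have d2 := box_diam (Sq X SX) (Sq p Sp).
  have T3 := dot_le (G X - G p) (Y - X).
  have nY := enorm2_ge0 (Y - X); have nX := enorm2_ge0 (X - p).
  have fX := Seta X SX; have fY := Seta Y SY.
  have T4 : `|dot (G X - G p) (Y - X)| <= 2 * C * l * enorm2 (Y - X).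
    apply: (le_trans T3); apply: ler_wpM2r => //; apply: (le_trans T2); nra.
  have T5 : C * enorm2 (Y - X) ^+ 2 <= 2 * C * l * enorm2 (Y - X).
    rewrite expr2 mulrA; apply: ler_wpM2r => //; nra.
  have {}T1 := le_trans T1 T5.
  have T6 : `|dot (G p) (Y - X)| <= 2 * eta + 4 * C * l * enorm2 (Y - X).
    have -> : dot (G p) (Y - X) =
        (f Y - f X) - (f Y - f X - dot (G X) (Y - X)) - dot (G X - G p) (Y - X).
      by rewrite /dot /=; ring.
    move: T1 T4 fX fY; rewrite !ler_norml => /andP[? ?] /andP[? ?] /andP[? ?] /andP[? ?].
    by apply/andP; split; lra.
  have T7 := enorm2_le_sum (Y - X); rewrite /= in T7.
  have T8 : `|(G p).2| * `|Y.2 - X.2| <= B * `|Y.1 - X.1| + `|dot (G p) (Y - X)|.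
    rewrite -!normrM.
    have -> : (G p).2 * (Y.2 - X.2) = dot (G p) (Y - X) - (G p).1 * (Y.1 - X.1).
      by rewrite /dot /=; ring.
    by apply: (le_trans (ler_normB _ _)); rewrite addrC.
  have n1 := normr_ge0 (Y.1 - X.1); have n2 := normr_ge0 (Y.2 - X.2).
  (* Because 4 C l <= ga / 8 and (B + ga) d <= eta, this leaves (3/8) ga |Y.2 - X.2| <= 3 eta. *)
  have T9 : ga / 2 * `|Y.2 - X.2| <= B * d + 2 * eta + ga / 8 * (d + `|Y.2 - X.2|).
    apply: (le_trans (ler_wpM2r n2 gap)); apply: (le_trans T8).
    rewrite -addrA; apply: lerD; first exact: ler_wpM2l.
    apply: (le_trans T6); apply: lerD => //.
    apply: (@le_trans _ _ (4 * C * l * (d + `|Y.2 - X.2|))).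
      apply: ler_wpM2l; first by rewrite !mulr_ge0// ltW.
      by apply: (le_trans T7); rewrite lerD2r.
    apply: ler_wpM2r; last lra.
    by rewrite addr_ge0// ltW.
  by rewrite ler_pdivlMr//; nra.
have -> : 32 * l * eta / ga = N.+1%:R * (d * (32 * eta / ga)).
  by rewrite -NdE; ring.
have h32 : 0 <= 32 * eta / ga by rewrite divr_ge0// ?ltW// mulr_gt0.
apply: (@covered_columns _ _ _ d N q.1); first exact: ltW; last first.
  by move=> X SX; rewrite NdE; have [] := Sq X SX.
move=> x; have [[X0 [SX0 X0x]]|nX] := pselect (exists X0, (S `&` [set X | x <= X.1 <= x + d]) X0); last first.
  apply: covered0; first by rewrite mulr_ge0// ltW.
  by move=> X SX; apply: nX; exists X.
apply: (@covered_box _ _ ((x, X0.2 - 16 * eta / ga), (d, 32 * eta / ga))) => //=; first exact: ltW.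
move=> Y [SY Yx]; split => //=.
have : `|Y.2 - X0.2| <= 8 * eta / ga.
  apply: key => //; move: X0x Yx => /= /andP[? ?] /andP[? ?].
  by rewrite ler_norml; apply/andP; split; lra.
have : 0 <= 8 * eta / ga by rewrite divr_ge0// ?ltW// mulr_gt0.
have -> : 32 * eta / ga = 4 * (8 * eta / ga) by ring.
have -> : 16 * eta / ga = 2 * (8 * eta / ga) by ring.
rewrite ler_norml => ? /andP[? ?].
by apply/andP; split; lra.
Qed.

(** Some component of [G p] has size at least [ga / 2]; if it is the first one, the coordinates are
    exchanged. *)
Lemma area_cell S f G C eta ga l p q :
  0 < l -> 0 < eta -> 0 < ga -> 0 <= C -> 32 * C * l <= ga ->
  S `<=` box (q, (l, l)) -> S p -> ga <= enorm2 (G p) ->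
  quad_approx S f G C -> (forall X, S X -> `|f X| <= eta) ->
  covered S (32 * l * eta / ga).
Proof.
move=> l0 eta0 ga0 C0 Cl Sq Sp gap T Seta.
have [h|h] := leP (ga / 2) `|(G p).2|.
  exact: (area_cell_vertical l0 eta0 ga0 C0 Cl Sq Sp h T Seta).
apply: covered_swap.
pose sw (X : R * R) := (X.2, X.1).
have nsw X : enorm2 (sw X) = enorm2 X by rewrite /enorm2 /= addrC.
apply: (@area_cell_vertical _ (f \o sw) (sw \o G \o sw) C eta ga l (sw p) (sw q)) => //.
- by move=> X /Sq[? ?]; split.
- by rewrite /sw /= -surjective_pairing.
- rewrite /sw /= -surjective_pairing; have := enorm2_le_sum (G p); lra.
- move=> X Y SX SY; have [h1 h2] := T (sw X) (sw Y) SX SY.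
  have e1 : enorm2 (sw Y - sw X) = enorm2 (Y - X) by rewrite -nsw.
  rewrite e1 in h1 h2; split.
    by apply: le_trans h1; rewrite /dot /sw /= [X in _ - X]addrC.
  by apply: le_trans h2; rewrite -nsw.
- by move=> X SX; exact: Seta.
Qed.

End Area.

(** * Sublevel sets of functions that are uniformly convex or have an expanding gradient *)

Section AreaGlobal.
Context {R : realType}.
Implicit Types (S : set (R * R)) (f : R * R -> R) (G : R * R -> R * R).

(* At scale [s] the points with [|G| >= ga ~ s] contribute O(eta), and by the  *)
(* lower bound on [G] the others fit in a square of half the side; each        *)
(* halving therefore costs O(eta), which is the source of the logarithm.       *)
Lemma area_log S f G C c eta s q k n :
  0 < s -> 0 < eta -> 0 < C -> 0 < c -> 256 * C <= c * k.+1%:R ->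
  S `<=` box (q, (s, s)) -> quad_approx S f G C ->
  (forall X Y, S X -> S Y -> c * enorm2 (Y - X) <= enorm2 (G Y - G X)) ->
  (forall X, S X -> `|f X| <= eta) ->
  covered S (n%:R * (k.+1%:R ^+ 2 * (eta / C)) + (s / 2 ^+ n) ^+ 2).
Proof.
move=> s0 eta0 C0 c0 kC; elim: n S s q s0 => [|n IH] S s q s0 Sq T Gc Seta.
  rewrite mul0r add0r expr0 divr1 expr2.
  by apply: (@covered_box _ _ (q, (s, s))) => //=; exact: ltW.
have k0 : 0 < k.+1%:R :> R by rewrite ltr0n.
(* Makes the condition [32 * C * l <= ga] of [area_cell] an equality for cells of side
   [s / k.+1%:R]. *)
pose ga := 32 * C * (s / k.+1%:R).
have sk0 : 0 < s / k.+1%:R by rewrite divr_gt0.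
have ga0 : 0 < ga by rewrite !mulr_gt0.
pose Sg := S `&` [set X | ga <= enorm2 (G X)].
pose Sb := S `&` [set X | enorm2 (G X) < ga].
have cg : covered Sg (k.+1%:R ^+ 2 * (eta / C)).
  apply: (@covered_grid _ _ _ s k q); [exact: ltW | | by move=> X [/Sq]].
  move=> q'; have [[p [Sgp pq]]|nS] :=
    pselect (exists p, (Sg `&` box (q', (s / k.+1%:R, s / k.+1%:R))) p); last first.
    by apply: covered0; [rewrite divr_ge0// ltW | move=> X h; apply: nS; exists X].
  have -> : eta / C = 32 * (s / k.+1%:R) * eta / ga.
    by rewrite /ga; field; rewrite !gt_eqF.
  apply: (@area_cell _ _ f G C eta ga (s / k.+1%:R) p q') => //.
  - exact: ltW.
  - exact: (proj2 Sgp).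
  - by apply: quad_approx_sub T => X [[]].
  - by move=> X [[SX _] _]; exact: Seta.
have cb : covered Sb (n%:R * (k.+1%:R ^+ 2 * (eta / C)) + (s / 2 / 2 ^+ n) ^+ 2).
  have [[X0 [SX0 GX0]]|nS] := pselect (exists X, Sb X); last first.
    apply: covered0; last by move=> X h; apply: nS; exists X.
    by rewrite addr_ge0 ?sqr_ge0// mulr_ge0// mulr_ge0 ?sqr_ge0// divr_ge0 ?ltW.
  apply: (IH _ _ (X0.1 - s / 4, X0.2 - s / 4)).
  - by rewrite divr_gt0.
  - move=> X [SX GX].
    suff : enorm2 (X - X0) <= s / 4.
      by move/ball_box; rewrite (_ : 2 * (s / 4) = s / 2)//; field.
    have h1 := Gc X0 X SX0 SX.
    have h2 := enorm2D (G X) (- G X0); rewrite enorm2N in h2.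
    have h3 : c * enorm2 (X - X0) <= 2 * ga by rewrite /= in GX GX0; lra.
    (* This is where k enters: two points of [Sb] have gradients at most 2 ga apart, hence lie
       within s / 4 of each other. *)
    have h4 : 2 * ga <= c * (s / 4).
      have -> : 2 * ga = s / 4 * (256 * C) / k.+1%:R.
        by rewrite /ga; field; rewrite gt_eqF.
      rewrite ler_pdivrMr//.
      have s4 : 0 <= s / 4 by rewrite divr_ge0// ltW.
      by have := ler_wpM2l s4 kC; lra.
    by rewrite -(ler_pM2l c0); exact: le_trans h3 h4.
  - by apply: quad_approx_sub T => X [].
  - by move=> X Y [? _] [? _]; exact: Gc.
  - by move=> X [? _]; exact: Seta.
apply: (covered_sub _ _ (coveredU cg cb)).
  by move=> X SX; have [h|h] := leP ga (enorm2 (G X)); [left|right].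
have -> : s / 2 ^+ n.+1 = s / 2 / 2 ^+ n by rewrite exprS invfM mulrA.
by rewrite -[n.+1%:R]natr1; lra.
Qed.

(* If |G| is small somewhere, convexity confines S to a ball of radius         *)
(* O(sqrt eta). Otherwise it confines S to a ball of radius O(inf |G|), which  *)
(* boundedly many cells with |G| comparable to inf |G| suffice to cover.       *)
Lemma area_convex S f G C c eta k :
  0 < eta -> 0 < C -> 0 < c -> 512 * C <= c * k.+1%:R ->
  quad_approx S f G C ->
  (forall X Y, S X -> S Y ->
     dot (G X) (Y - X) + c / 2 * enorm2 (Y - X) ^+ 2 <= f Y - f X) ->
  (forall X, S X -> `|f X| <= eta) ->
  covered S (512 * k.+1%:R * eta / c).
Proof.
move=> eta0 C0 c0 kC T conv Seta.
have k0 : 0 < k.+1%:R :> R by rewrite ltr0n.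
(* Uniform convexity at [X1], with |f| <= eta at both points. *)
have dist X1 X : S X1 -> S X ->
    c * enorm2 (X - X1) ^+ 2 <= 4 * eta + 2 * enorm2 (G X1) * enorm2 (X - X1).
  move=> S1 SX; have h1 := conv X1 X S1 SX.
  have := dot_le (G X1) (X - X1); have := Seta _ S1; have := Seta _ SX.
  rewrite !ler_norml => /andP[? ?] /andP[? ?] /andP[? ?]; lra.
have ce0 : 0 <= c * eta by rewrite mulr_ge0// ltW.
(* At |G|^2 = c eta the two terms on the right of [dist] balance. *)
have [[X1 [S1 G1]]|big] := pselect (exists X1, S X1 /\ enorm2 (G X1) ^+ 2 <= c * eta).
  pose d := Num.sqrt (12 * eta / c).
  have q0 : 0 <= 12 * eta / c by rewrite divr_ge0 ?mulr_ge0 ?ltW.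
  have d2 : d ^+ 2 = 12 * eta / c by rewrite sqr_sqrtr.
  have dd : (2 * d) * (2 * d) = 48 * eta / c.
    by move: d2; rewrite expr2 => h; rewrite mulrACA h; field; rewrite gt_eqF.
  have d0 : 0 <= d by exact: sqrtr_ge0.
  apply: (@covered_sub _ _ S ((2 * d) * (2 * d))) => //.
    rewrite dd; apply: ler_wpM2r; first by rewrite invr_ge0 ltW.
    apply: ler_wpM2r; first exact: ltW.
    have : 1 <= k.+1%:R :> R by rewrite ler1n.
    lra.
  apply: (@covered_box _ _ ((X1.1 - d, X1.2 - d), (2 * d, 2 * d))); rewrite /= ?mulr_ge0//.
  move=> X SX; apply: ball_box; rewrite -ler_sqr ?nnegrE ?enorm2_ge0//.
  rewrite d2 ler_pdivlMr//.
  have h := dist X1 X S1 SX.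
  set e := enorm2 (X - X1) in h *; set nu := enorm2 (G X1) in h G1.
  have h2 : 2 * nu * e * c <= c * e ^+ 2 / 2 * c + 2 * c * eta.
    by have := sqr_ge0 (c * e - 2 * nu); lra.
  have h3 : 2 * nu * e <= c * e ^+ 2 / 2 + 2 * eta.
    by rewrite -(ler_pM2r c0); lra.
  by rewrite mulrC; lra.
have [[X2 S2]|nS] := pselect (exists X, S X); last first.
  apply: covered0; last by move=> X SX; apply: nS; exists X.
  apply: divr_ge0; last exact: ltW.
  by apply: mulr_ge0; [apply: mulr_ge0; exact: ler0n | exact: ltW].
pose E := [set enorm2 (G X) | X in S].
have hE : has_inf E.
  split; first by exists (enorm2 (G X2)), X2.
  by exists 0 => _ [X _ <-]; exact: enorm2_ge0.
have Gbig X : S X -> Num.sqrt (c * eta) <= enorm2 (G X).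
  move=> SX; apply: le_enorm2; first exact: sqrtr_ge0.
  rewrite (sqr_sqrtr ce0) -enorm2_sqr leNgt; apply/negP => /ltW h.
  by apply: big; exists X.
pose mu := inf E.
have mu1 : Num.sqrt (c * eta) <= mu.
  by apply: lb_le_inf; [by case: hE | move=> _ [X SX <-]; exact: Gbig].
have mu0 : 0 < mu by apply: lt_le_trans mu1; rewrite sqrtr_gt0 mulr_gt0.
have muc : c * eta <= mu ^+ 2.
  rewrite -(sqr_sqrtr ce0) ler_sqr ?nnegrE ?sqrtr_ge0//; exact: ltW.
have Gmu X : S X -> mu <= enorm2 (G X).
  by move=> SX; apply: ge_inf; [by case: hE | exists X].
(* The infimum need not be attained; a point with |G| < 2 mu serves as centre. *)
have [_ [X1 S1 <-] G1] := inf_adherent mu0 hE; rewrite -/mu in G1.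
have near X : S X -> enorm2 (X - X1) <= 8 * mu / c.
  move=> SX; rewrite ler_pdivlMr//; have h := dist X1 X S1 SX.
  set e := enorm2 (X - X1) in h *; have e0 : 0 <= e by exact: enorm2_ge0.
  rewrite leNgt; apply/negP => hlt.
  have h1 : c * e ^+ 2 <= 4 * eta + 4 * mu * e 
    by apply: (le_trans h); rewrite lerD2l ler_wpM2r//; lra.
  have h2 : (c * e) ^+ 2 <= 4 * mu ^+ 2 + 4 * mu * (c * e).
    have := ler_wpM2l (ltW c0) h1; rewrite exprMn; lra.
  have h3 : 0 < (c * e - 8 * mu) * (c * e) by rewrite mulr_gt0//; lra.
  have h4 : 0 < (c * e - 8 * mu) * mu by rewrite mulr_gt0//; lra.
  lra.
pose l := 2 * (8 * mu / c).
have l0 : 0 < l by rewrite mulr_gt0// divr_gt0// mulr_gt0.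
have -> : 512 * k.+1%:R * eta / c =
    k.+1%:R ^+ 2 * (32 * (l / k.+1%:R) * eta / mu).
  by rewrite /l; field; rewrite !gt_eqF.
apply: (@covered_grid _ _ _ l k (X1.1 - 8 * mu / c, X1.2 - 8 * mu / c)); first exact: ltW; last first.
  by move=> X /near/ball_box.
move=> q'; have [[p [Sp pq]]|nS] :=
  pselect (exists p, (S `&` box (q', (l / k.+1%:R, l / k.+1%:R))) p); last first.
  apply: covered0; last by move=> X h; apply: nS; exists X.
  by rewrite divr_ge0 ?mulr_ge0 ?invr_ge0 ?ltW.
apply: (@area_cell _ _ f G C eta mu (l / k.+1%:R) p q') => //.
- by rewrite divr_gt0.
- exact: ltW.
- rewrite (_ : 32 * C * (l / k.+1%:R) = mu * (512 * C) / (c * k.+1%:R)).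
    have ck0 : 0 < c * k.+1%:R by rewrite mulr_gt0.
    by rewrite (ler_pdivrMr _ _ ck0); have := ler_wpM2l (ltW mu0) kC; lra.
  by rewrite /l; field; rewrite !gt_eqF.
- exact: Gmu.
- by apply: quad_approx_sub T => X [].
- by move=> X [SX _]; exact: Seta.
Qed.

End AreaGlobal.

(** * Radial functions along lines *)

Section Lines.
Context {R : realType}.
Implicit Types (X Y Z P : R * R) (h a b : R -> R).

Definition line Y Z (s : R) : R * R := Y + sc s Z.

Lemma is_derive_enorm2_line Y Z s : 0 < enorm2 (line Y Z s) ->
  is_derive s 1 (fun s => enorm2 (line Y Z s))
    (dot (line Y Z s) Z / enorm2 (line Y Z s)).
Proof.
move=> h.
have q0 : 0 < (line Y Z s).1 ^+ 2 + (line Y Z s).2 ^+ 2 by rewrite -sqrtr_gt0.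
have d1 : is_derive s 1 (fun s => (line Y Z s).1 ^+ 2 + (line Y Z s).2 ^+ 2)
   (2 * dot (line Y Z s) Z).
  rewrite /line /dot /=; apply: is_derive_eq.
  by rewrite /GRing.scale /=; ring.
have d2 := is_derive1_sqrt q0.
have d3 := @is_derive1_comp R Num.sqrt (fun s => (line Y Z s).1 ^+ 2 + (line Y Z s).2 ^+ 2) s _ _ d2 d1.
apply: (is_derive_eq d3).
by rewrite -/(enorm2 (line Y Z s)) /GRing.scale /=; field; rewrite gt_eqF.
Qed.

(* For the radial function X |-> h |X| with h' = a and h'' = b. *)
Definition grad_radial a P : R * R := sc (a (enorm2 P) / enorm2 P) P.

(** The Hessian as a bilinear form: eigenvalue b along [P] and a / |P| across it. *)
Definition hess_radial a b P Z Z' : R :=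
  b (enorm2 P) * (dot P Z / enorm2 P) * (dot P Z' / enorm2 P)
  + a (enorm2 P) / enorm2 P
    * (dot Z Z' - (dot P Z / enorm2 P) * (dot P Z' / enorm2 P)).

Lemma is_derive_radial_line h a Y Z s : 0 < enorm2 (line Y Z s) ->
  is_derive (enorm2 (line Y Z s)) 1 h (a (enorm2 (line Y Z s))) ->
  is_derive s 1 (fun s => h (enorm2 (line Y Z s)))
    (dot (grad_radial a (line Y Z s)) Z).
Proof.
move=> n0 dh; have d := @is_derive1_comp R h (fun s => enorm2 (line Y Z s)) s _ _ dh (is_derive_enorm2_line n0).
apply: (is_derive_eq d).
by rewrite /GRing.scale /grad_radial /dot /=; field; rewrite gt_eqF.
Qed.

Lemma is_derive_grad_line a b Y Z Z' s : 0 < enorm2 (line Y Z s) ->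
  is_derive (enorm2 (line Y Z s)) 1 a (b (enorm2 (line Y Z s))) ->
  is_derive s 1 (fun s => dot (grad_radial a (line Y Z s)) Z')
    (hess_radial a b (line Y Z s) Z Z').
Proof.
move=> n0 dh.
have d1 := is_derive_enorm2_line n0.
have d2 := @is_derive1_comp R a (fun s => enorm2 (line Y Z s)) s _ _ dh d1.
have d3 : is_derive s 1 (fun s => dot (line Y Z s) Z') (dot Z Z').
  rewrite /line /dot /=; apply: is_derive_eq.
  by rewrite /GRing.scale /=; ring.
have d4 := @is_deriveV R (fun s => enorm2 (line Y Z s)) s _ 1 (lt0r_neq0 n0) d1.
have d5 := is_deriveM (is_deriveM d2 d4) d3.
rewrite (_ : (fun s => _) = (((a \o (fun s => enorm2 (line Y Z s))) *
   (fun s => (enorm2 (line Y Z s))^-1)) * (fun s => dot (line Y Z s) Z')));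
  last by apply/funext => x; rewrite !fctE /grad_radial /dot /=; ring.
apply: (is_derive_eq d5).
by rewrite !fctE /GRing.scale /hess_radial /=; field; rewrite gt_eqF.
Qed.

Lemma MVT01 (phi dphi : R -> R) :
  (forall s : R, 0 <= s <= 1 -> is_derive s 1 phi (dphi s)) ->
  exists2 s : R, 0 < s < 1 & phi 1 - phi 0 = dphi s.
Proof.
move=> d; have [||s s01 ->] := @MVT R phi dphi 0 1 ltr01.
- by move=> x; rewrite in_itv /= => /andP[? ?]; apply: d; rewrite !ltW.
- apply: derivable_within_continuous => x; rewrite in_itv /= => /d dx.
  exact: ex_derive.
- by exists s; [rewrite in_itv /= in s01 | rewrite subr0 mulr1].
Qed.

End Lines.

(** * Unit vectors and directions *)

Section UnitVectors.
Context {R : realType}.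
Implicit Types (X Y Z n : R * R).

Lemma dot_unit_le n Z : enorm2 n = 1 -> `|dot n Z| <= enorm2 Z.
Proof. by move=> n1; rewrite -[leRHS]mul1r -n1; exact: dot_le. Qed.

Lemma dot_unit_diff n n' Z Z' : enorm2 n = 1 -> enorm2 n' = 1 ->
  `|dot n Z * dot n Z' - dot n' Z * dot n' Z'|
    <= 2 * enorm2 (n - n') * (enorm2 Z * enorm2 Z').
Proof.
move=> h h'.
have -> : dot n Z * dot n Z' - dot n' Z * dot n' Z' =
    dot (n - n') Z * dot n Z' + dot n' Z * dot (n - n') Z'.
  by rewrite /dot /=; ring.
apply: (le_trans (ler_normD _ _)); rewrite !normrM.
have -> : 2 * enorm2 (n - n') * (enorm2 Z * enorm2 Z') =
    (enorm2 (n - n') * enorm2 Z) * enorm2 Z'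
    + enorm2 Z * (enorm2 (n - n') * enorm2 Z') by ring.
by apply: lerD; apply: ler_pM; rewrite ?dot_le ?dot_unit_le.
Qed.

Lemma unit_dir X : 0 < enorm2 X -> enorm2 (sc (enorm2 X)^-1 X) = 1.
Proof.
by move=> h; rewrite enorm2_sc ger0_norm ?invr_ge0 ?ltW// mulVf// gt_eqF.
Qed.

Lemma unit_dir_dist X Y : 1 <= enorm2 X -> 1 <= enorm2 Y ->
  enorm2 (sc (enorm2 X)^-1 X - sc (enorm2 Y)^-1 Y) <= 2 * enorm2 (X - Y).
Proof.
move=> X1 Y1; have X0 := lt_le_trans ltr01 X1; have Y0 := lt_le_trans ltr01 Y1.
have -> : sc (enorm2 X)^-1 X - sc (enorm2 Y)^-1 Y =
    sc (enorm2 X)^-1 ((X - Y) + sc ((enorm2 Y - enorm2 X) / enorm2 Y) Y).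
  by apply/eqP; rewrite xpair_eqE /=; apply/andP; split; apply/eqP; field; rewrite !gt_eqF.
rewrite enorm2_sc ger0_norm ?invr_ge0 ?enorm2_ge0// ler_pdivrMl//.
apply: (le_trans (enorm2D _ _)); rewrite enorm2_sc normrM normfV (ger0_norm (enorm2_ge0 Y)).
rewrite divfK ?gt_eqF//.
have := enorm2_dist Y X; rewrite (enorm2B Y X); have := enorm2_ge0 (X - Y); nra.
Qed.

(** The vector is the reflection of [Z] in the line spanned by [n]. Used as a multiplier, it turns a
    saddle-shaped Hessian into a definite form. *)
Lemma enorm2_reflect n Z : enorm2 n = 1 ->
  enorm2 (sc (2 * dot n Z) n - Z) = enorm2 Z.
Proof.
move=> n1; apply/eqP; rewrite -(@eqrXn2 _ 2) ?enorm2_ge0// !enorm2_sqr; apply/eqP.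
have -> : dot (sc (2 * dot n Z) n - Z) (sc (2 * dot n Z) n - Z) =
  4 * dot n Z ^+ 2 * dot n n - 4 * dot n Z * dot n Z + dot Z Z.
  by rewrite /dot /=; ring.
by rewrite -[dot n n]enorm2_sqr n1; ring.
Qed.

(* |p n - q n'|^2 = (p - q)^2 + p q |n - n'|^2 for unit vectors: no case       *)
(* distinction on the angle between n and n' is needed when p q > 0.           *)
Lemma unit_comb_ge n n' (p q m e : R) :
  enorm2 n = 1 -> enorm2 n' = 1 -> 0 < m -> m <= p -> m <= q -> 0 <= e ->
  enorm2 (sc p n - sc q n') <= e ->
  `|p - q| <= e /\ m * enorm2 (n - n') <= e.
Proof.
move=> n1 n'1 m0 mp mq e0 he.
have := enorm2_sqr n; have := enorm2_sqr n'; rewrite n1 n'1 expr1n => d' d.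
have h : enorm2 (sc p n - sc q n') ^+ 2 = (p - q) ^+ 2 + p * q * enorm2 (n - n') ^+ 2.
  rewrite !enorm2_sqr.
  have -> : dot (sc p n - sc q n') (sc p n - sc q n') =
     p ^+ 2 * dot n n + q ^+ 2 * dot n' n' - 2 * p * q * dot n n'.
    by rewrite /dot /=; ring.
  have -> : dot (n - n') (n - n') = dot n n + dot n' n' - 2 * dot n n'.
    by rewrite /dot /=; ring.
  by rewrite -d -d'; ring.
have he2 : (p - q) ^+ 2 + p * q * enorm2 (n - n') ^+ 2 <= e ^+ 2.
  by rewrite -h ler_sqr ?nnegrE ?enorm2_ge0.
have pq : m ^+ 2 <= p * q by rewrite expr2 ler_pM// ltW.
have sn := sqr_ge0 (enorm2 (n - n')); have sp := sqr_ge0 (p - q).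
have pq' := ler_wpM2r sn pq.
have m2 := mulr_ge0 (sqr_ge0 m) sn.
split.
  rewrite -ler_sqr ?nnegrE// real_normK ?num_real//; lra.
have mn : 0 <= m * enorm2 (n - n') by rewrite mulr_ge0 ?enorm2_ge0// ltW.
by rewrite -ler_sqr ?nnegrE// exprMn; lra.
Qed.

End UnitVectors.

(* Two profiles [u], [w] (with first and second derivatives [u1], [u2], [w1],  *)
(* [w2]) of surfaces of revolution whose parameters are at distance [Dl];      *)
(* [sg] is 1 in the hyperbolic case and -1 in the elliptic case.               *)
Record profile_pair {R : realType} (t0 t1 L m0 l1 kap cs sg Dl : R)
    (u u1 u2 w w1 w2 : R -> R) : Prop := {
  pp_t0 : 1 <= t0;
  pp_t1 : t1 <= 2;
  pp_L : 1 <= L;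
  pp_m0 : 0 < m0;
  pp_l1 : 0 < l1;
  pp_cs : 0 < cs;
  pp_kap : 2 * cs <= kap;
  pp_sg : sg = 1 \/ sg = -1;
  pp_Dl : 0 < Dl;
  pp_du : forall t : R, t0 < t < t1 -> is_derive t 1 u (u1 t);
  pp_du1 : forall t : R, t0 < t < t1 -> is_derive t 1 u1 (u2 t);
  pp_dw : forall t : R, t0 < t < t1 -> is_derive t 1 w (w1 t);
  pp_dw1 : forall t : R, t0 < t < t1 -> is_derive t 1 w1 (w2 t);
  pp_u1 : forall t : R, t0 < t < t1 -> m0 <= u1 t <= L;
  pp_w1 : forall t : R, t0 < t < t1 -> m0 <= w1 t <= L;
  pp_w2 : forall t : R, t0 < t < t1 -> `|w2 t| <= L;
  pp_lip_w1 : forall t s : R, t0 < t < t1 -> t0 < s < t1 ->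
    `|w1 t - w1 s| <= L * `|t - s|;
  pp_lip1 : forall t s : R, t0 < t < t1 -> t0 < s < t1 ->
    `|u1 t - w1 s| <= L * (Dl + `|t - s|);
  pp_lip2 : forall t s : R, t0 < t < t1 -> t0 < s < t1 ->
    `|u2 t - w2 s| <= L * (Dl + `|t - s|);
  pp_lam : forall t : R, t0 < t < t1 -> l1 * Dl <= `|u1 t - w1 t|;
  pp_curv : forall t s : R, t0 < t < t1 -> t0 < s < t1 ->
    kap * (Dl + `|t - s|) <= `|u1 t - w1 s| + `|u2 t - w2 s|;
  pp_sign : forall t s : R, t0 < t < t1 -> t0 < s < t1 -> t <> s ->
    `|u1 t - w1 s| <= cs * (Dl + `|t - s|) -> 0 < sg * (u2 t - w2 s) * (t - s)
}.

(** * The Hessian of the gap and its approximate eigenvalues *)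

Section Pointwise.
Context {R : realType} {t0 t1 L m0 l1 kap cs sg Dl : R}.
Context {u u1 u2 w w1 w2 : R -> R}.
Context (pp : profile_pair t0 t1 L m0 l1 kap cs sg Dl u u1 u2 w w1 w2).
Context (v : R * R).
Implicit Types (P Z : R * R).

Local Notation M := (Dl + enorm2 v).

(** Both radii are interior, where derivatives relative to the closed interval are ordinary ones. *)
Definition dom t0 t1 v P : Prop :=
  t0 < enorm2 P < t1 /\ t0 < enorm2 (P - v) < t1.
Definition gap u w v P : R := u (enorm2 P) - w (enorm2 (P - v)).
Definition grad u1 w1 v P : R * R := grad_radial u1 P - grad_radial w1 (P - v).
Definition hess u1 u2 w1 w2 v P Z Z' : R :=
  hess_radial u1 u2 P Z Z' - hess_radial w1 w2 (P - v) Z Z'.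
Definition dir P : R * R := sc (enorm2 P)^-1 P.

Local Notation D := (dom t0 t1 v).

Lemma dom_ge1 P : D P -> 1 <= enorm2 P /\ 1 <= enorm2 (P - v).
Proof.
by move=> [/andP[/ltW h _] /andP[/ltW h' _]]; split;
  apply: le_trans (pp_t0 pp) _.
Qed.

Lemma dom_le2 P : D P -> enorm2 P <= 2 /\ enorm2 (P - v) <= 2.
Proof.
by move=> [/andP[_ /ltW h] /andP[_ /ltW h']]; split;
  apply: le_trans (pp_t1 pp).
Qed.

Lemma dist_radii P : `|enorm2 P - enorm2 (P - v)| <= enorm2 v.
Proof. by apply: (le_trans (enorm2_dist _ _)); rewrite opprB addrC subrK. Qed.

(* Approximate eigenvalues of the Hessian of [gap], along and across [dir P]. *)
Definition eig1 (u2 w2 : R -> R) v P : R := u2 (enorm2 P) - w2 (enorm2 (P - v)).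
Definition eig2 (u1 w1 : R -> R) v P : R :=
  u1 (enorm2 P) / enorm2 P - w1 (enorm2 (P - v)) / enorm2 (P - v).
Local Notation h1 := (eig1 u2 w2 v).
Local Notation h2 := (eig2 u1 w1 v).

(** Replacing the direction of P - v by that of P costs exactly w2 - w1 / |P - v|, a factor of size
    at most 2 L, times a difference of two rank-one forms. *)
Lemma hess_approx P Z Z' : D P ->
  `|hess u1 u2 w1 w2 v P Z Z' - (h1 P * (dot (dir P) Z * dot (dir P) Z')
     + h2 P * (dot Z Z' - dot (dir P) Z * dot (dir P) Z'))|
  <= 4 * L * enorm2 (dir P - dir (P - v)) * (enorm2 Z * enorm2 Z').
Proof.
move=> DP; have [r1 r1'] := dom_ge1 DP; have [_ Pv] := DP.
have r0 := lt_le_trans ltr01 r1; have r0' := lt_le_trans ltr01 r1'.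
have L1 := pp_L pp.
set n := dir P; set n' := dir (P - v).
have -> : hess u1 u2 w1 w2 v P Z Z' - (h1 P * (dot n Z * dot n Z')
     + h2 P * (dot Z Z' - dot n Z * dot n Z')) =
   (w2 (enorm2 (P - v)) - w1 (enorm2 (P - v)) / enorm2 (P - v))
    * (dot n Z * dot n Z' - dot n' Z * dot n' Z').
  rewrite /hess /hess_radial /eig1 /eig2 /n /n' /dir.
  have dsc c X Y : dot (sc c X) Y = c * dot X Y by rewrite /dot /=; ring.
  by rewrite !dsc; field; rewrite !gt_eqF.
rewrite normrM.
have -> : 4 * L * enorm2 (n - n') * (enorm2 Z * enorm2 Z') =
   (2 * L) * (2 * enorm2 (n - n') * (enorm2 Z * enorm2 Z')) by ring.
apply: ler_pM => //; last by apply: dot_unit_diff; exact: unit_dir.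
apply: (le_trans (ler_normB _ _)).
have -> : 2 * L = L + L by ring.
apply: lerD; first exact: pp_w2 pp _ Pv.
rewrite normrM normfV (ger0_norm (enorm2_ge0 _)) ler_pdivrMr//.
have /andP[a b] := pp_w1 pp Pv; have m00 := pp_m0 pp.
rewrite ger0_norm; nra.
Qed.

Lemma eig1_le P : D P -> `|h1 P| <= L * M.
Proof.
move=> [Pu Pv]; apply: (le_trans (pp_lip2 pp Pu Pv)).
apply: ler_wpM2l; first by have := pp_L pp; lra.
by rewrite lerD2l dist_radii.
Qed.

(** The first term is small near critical points; the second, proportional to the difference of the
    radii, survives there. *)
Lemma eig2E P : D P -> h2 P =
  (u1 (enorm2 P) - w1 (enorm2 (P - v))) / enorm2 P
  - w1 (enorm2 (P - v)) * (enorm2 P - enorm2 (P - v)) / (enorm2 P * enorm2 (P - v)).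
Proof.
move=> DP; have [r1 r1'] := dom_ge1 DP.
have r0 := lt_le_trans ltr01 r1; have r0' := lt_le_trans ltr01 r1'.
by rewrite /eig2; field; rewrite !gt_eqF.
Qed.

Lemma eig2_le P : D P -> `|h2 P| <= 2 * L * M.
Proof.
move=> DP; have [Pu Pv] := DP; rewrite (eig2E DP).
have [r1 r1'] := dom_ge1 DP.
have r0 := lt_le_trans ltr01 r1; have r0' := lt_le_trans ltr01 r1'.
have L1 := pp_L pp; have dr := dist_radii P.
have D0 := pp_Dl pp; have nv := enorm2_ge0 v.
apply: (le_trans (ler_normB _ _)).
have -> : 2 * L * M = L * M + L * M by ring.
apply: lerD.
  rewrite normrM normfV (ger0_norm (enorm2_ge0 _)) ler_pdivrMr//.
  apply: (le_trans (pp_lip1 pp Pu Pv)).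
  apply: (@le_trans _ _ (L * M)); first by apply: ler_wpM2l; [lra | rewrite lerD2l].
  by apply: ler_peMr => //; apply: mulr_ge0; lra.
rewrite !normrM normfV normrM !(ger0_norm (enorm2_ge0 _)).
rewrite ler_pdivrMr ?mulr_gt0//.
have /andP[a b] := pp_w1 pp Pv; have m00 := pp_m0 pp.
apply: (@le_trans _ _ (L * M)).
  apply: ler_pM => //; first by rewrite ger0_norm//; lra.
  by apply: (le_trans dr); lra.
apply: ler_peMr; first by apply: mulr_ge0; lra.
by rewrite -[1]mulr1; apply: ler_pM.
Qed.

Lemma dir_shift_le P : D P -> enorm2 (dir P - dir (P - v)) <= 2 * enorm2 v.
Proof.
move=> DP; have [r1 r1'] := dom_ge1 DP.
by apply: (le_trans (unit_dir_dist r1 r1')); rewrite opprB addrC subrK.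
Qed.

(** 13 = 1 + 2 * 2 + 8: the radial term, the tangential term, the error in the direction. *)
Lemma hess_le P Z Z' : D P ->
  `|hess u1 u2 w1 w2 v P Z Z'| <= 13 * L * M * (enorm2 Z * enorm2 Z').
Proof.
move=> DP; have [r1 _] := dom_ge1 DP; have r0 := lt_le_trans ltr01 r1.
have n1 : enorm2 (dir P) = 1 by exact: unit_dir.
have h := hess_approx Z Z' DP.
have L1 := pp_L pp; have D0 := pp_Dl pp; have nv := enorm2_ge0 v.
set W := enorm2 Z * enorm2 Z' in h *.
have W0 : 0 <= W by rewrite mulr_ge0 ?enorm2_ge0.
have e1 : `|dot (dir P) Z * dot (dir P) Z'| <= W.
  by rewrite normrM; apply: ler_pM; rewrite ?dot_unit_le.
have e2 : `|dot Z Z' - dot (dir P) Z * dot (dir P) Z'| <= 2 * W.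
  apply: (le_trans (ler_normB _ _)); have := dot_le Z Z'; rewrite -/W; lra.
have e3 : `|h1 P * (dot (dir P) Z * dot (dir P) Z')| <= L * M * W.
  by rewrite normrM; apply: ler_pM => //; exact: eig1_le.
have e4 : `|h2 P * (dot Z Z' - dot (dir P) Z * dot (dir P) Z')| <= 2 * L * M * (2 * W).
  by rewrite normrM; apply: ler_pM => //; exact: eig2_le.
have e5 : 4 * L * enorm2 (dir P - dir (P - v)) * W <= 8 * L * M * W.
  apply: ler_wpM2r => //; have := dir_shift_le DP; nra.
have {}h := le_trans h e5.
move: h e3 e4; rewrite !ler_norml => /andP[? ?] /andP[? ?] /andP[? ?].
by apply/andP; split; lra.
Qed.

End Pointwise.

(** * Points where the gradient of the gap is small compared with M *)

Section NearCritical.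
Context {R : realType} {t0 t1 L m0 l1 kap cs sg Dl : R}.
Context {u u1 u2 w w1 w2 : R -> R}.
Context (pp : profile_pair t0 t1 L m0 l1 kap cs sg Dl u u1 u2 w w1 w2).
Context {v : R * R}.
Context {c2 c3 c4 : R}.
Context (c20 : 0 < c2) (c30 : 0 < c3) (c40 : 0 < c4).
Context (c2a : 2 * c2 * (m0 + 2 * l1) <= l1 * m0).
Context (c3E : 2 * c3 * (L + l1) <= l1).
Context (c2b : c2 <= c3 * cs).
Context (c2c : 8 * c2 <= m0 * c3).
Context (c4a : 2 * c4 <= kap * c3).
Context (c4b : 8 * c4 <= m0 * c3).
Context (c2d : 32 * L * c2 <= m0 * c4).
Implicit Types (P Z : R * R).

Local Notation M := (Dl + enorm2 v).
Local Notation D := (dom t0 t1 v).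
Local Notation h1 := (eig1 u2 w2 v).
Local Notation h2 := (eig2 u1 w1 v).
Local Notation tau P := (enorm2 P - enorm2 (P - v)).

Let M0 : 0 < M.
Proof. by have := pp_Dl pp; have := enorm2_ge0 v; lra. Qed.

(** In units of M, [c2] bounds the gradient from above, [c3] the difference of the radii and [c4]
    both eigenvalues from below. *)
Definition nearcrit c P : Prop := D P /\ enorm2 (grad u1 w1 v P) <= c * M.

(** The gradient is u1 times one unit vector minus w1 times another, with both coefficients at least
    [m0], so [unit_comb_ge] applies. *)
Lemma nearcrit_dir P : nearcrit c2 P ->
  `|u1 (enorm2 P) - w1 (enorm2 (P - v))| <= c2 * M /\
  m0 * enorm2 (dir P - dir (P - v)) <= c2 * M.
Proof.
move=> [DP gP]; have [r1 r1'] := dom_ge1 pp DP; have [Pu Pv] := DP.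
have r0 := lt_le_trans ltr01 r1; have r0' := lt_le_trans ltr01 r1'.
have /andP[a _] := pp_u1 pp Pu; have /andP[b _] := pp_w1 pp Pv.
apply: (unit_comb_ge (unit_dir r0) (unit_dir r0') (pp_m0 pp) a b).
  by rewrite mulr_ge0// ltW.
apply: le_trans gP; rewrite /grad /grad_radial.
have scM (p q : R) X : sc p (sc q X) = sc (p * q) X by rewrite /sc /= !mulrA.
by rewrite !scM.
Qed.

(** The vector on the left is |P - v| (dir P - dir (P - v)), and |P - v| <= 2: the translation is
    almost radial, with signed length tau P. *)
Lemma nearcrit_shift P : nearcrit c2 P ->
  m0 * enorm2 (v - sc (tau P) (dir P)) <= 2 * c2 * M.
Proof.
move=> nP; have [_ h] := nearcrit_dir nP; have [DP _] := nP.
have [r1 r1'] := dom_ge1 pp DP; have [_ r2'] := dom_le2 pp DP.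
have r0 := lt_le_trans ltr01 r1; have r0' := lt_le_trans ltr01 r1'.
have -> : v - sc (tau P) (dir P) = sc (enorm2 (P - v)) (dir P - dir (P - v)).
  apply/eqP; rewrite /dir xpair_eqE /=; apply/andP; split; apply/eqP; field;
  by rewrite !gt_eqF.
rewrite enorm2_sc (ger0_norm (enorm2_ge0 _)) mulrCA.
have m00 := pp_m0 pp; have n0 := enorm2_ge0 (dir P - dir (P - v)).
have : 0 <= m0 * enorm2 (dir P - dir (P - v)) by apply: mulr_ge0 => //; exact: ltW.
nra.
Qed.

(** Both summands of M are controlled by |tau P|: |v| by [nearcrit_shift], and [Dl] because u1 and
    w1 differ by at least l1 Dl at a common radius, nearly agree at the two actual radii, and w1 is
    Lipschitz. *)
Lemma nearcrit_tau P : nearcrit c2 P -> c3 * M <= `|tau P|.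
Proof.
move=> nP; have [h _] := nearcrit_dir nP; have hv := nearcrit_shift nP.
have [DP _] := nP; have [Pu Pv] := DP.
have [r1 r1'] := dom_ge1 pp DP; have r0 := lt_le_trans ltr01 r1.
have m00 := pp_m0 pp; have l10 := pp_l1 pp; have L1 := pp_L pp.
have D0 := pp_Dl pp.
have e1 : l1 * Dl <= c2 * M + L * `|tau P|.
  apply: (le_trans (pp_lam pp Pu)); have := pp_lip_w1 pp Pu Pv.
  move: h; rewrite !ler_norml => /andP[? ?] /andP[? ?].
  by apply/andP; split; lra.
have e2 : m0 * enorm2 v <= m0 * `|tau P| + 2 * c2 * M.
  have := enorm2D (v - sc (tau P) (dir P)) (sc (tau P) (dir P)).
  rewrite subrK enorm2_sc (unit_dir r0) mulr1 => e.
  have := ler_wpM2l (ltW m00) e; rewrite mulrDr; lra.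
have t0' := normr_ge0 (tau P).
have e3 : l1 * m0 * M <= 2 * m0 * (L + l1) * `|tau P|.
  have := ler_wpM2l (ltW m00) e1; have := ler_wpM2l (ltW l10) e2.
  by have := ler_wpM2r (ltW M0) c2a; lra.
have e4 : 2 * m0 * (L + l1) * (c3 * M) <= 2 * m0 * (L + l1) * `|tau P|.
  apply: le_trans e3; have := ler_wpM2r (ltW (mulr_gt0 m00 M0)) c3E; lra.
by move: e4; rewrite ler_pM2l// !mulr_gt0//; lra.
Qed.

(** As u1 and w1 nearly agree, the lower bound [pp_curv] falls on h1, and [pp_sign] gives its sign;
    h2 is dominated by the second term of [eig2E], of sign opposite to tau P. So h1 and h2 have
    equal signs for sg = -1 and opposite signs for sg = 1. *)
Lemma nearcrit_sign P : nearcrit c2 P ->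
  exists2 s : R, s = 1 \/ s = -1 &
    [/\ s * tau P = `|tau P|, c4 * M <= sg * s * h1 P & c4 * M <= - s * h2 P].
Proof.
move=> nP; have [h _] := nearcrit_dir nP; have ht := nearcrit_tau nP.
have [DP _] := nP; have [Pu Pv] := DP.
have [r1 r1'] := dom_ge1 pp DP; have [r2 r2'] := dom_le2 pp DP.
have r0 := lt_le_trans ltr01 r1; have r0' := lt_le_trans ltr01 r1'.
have m00 := pp_m0 pp; have cs0 := pp_cs pp; have kc := pp_kap pp.
have D0 := pp_Dl pp.
set T := tau P in ht *; have T0 : 0 < `|T| by apply: lt_le_trans ht; rewrite mulr_gt0.
have hcs : `|u1 (enorm2 P) - w1 (enorm2 (P - v))| <= cs * (Dl + `|T|).
  apply: (le_trans h); apply: (@le_trans _ _ (cs * `|T|)); last first.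
    by apply: ler_wpM2l; [exact: ltW | lra].
  have := ler_wpM2r (ltW M0) c2b; have := ler_wpM2l (ltW cs0) ht; lra.
have neq : enorm2 P <> enorm2 (P - v).
  by move=> e; move: T0; rewrite /T e subrr normr0 ltxx.
have sgn := pp_sign pp Pu Pv neq hcs; rewrite -/(h1 P) -/T in sgn.
have curv := pp_curv pp Pu Pv; rewrite -/(h1 P) -/T in curv.
have big : c4 * M <= `|h1 P|.
  have e1 : kap / 2 * (Dl + `|T|) <= `|h1 P|.
    have : cs * (Dl + `|T|) <= kap / 2 * (Dl + `|T|) by apply: ler_wpM2r; lra.
    lra.
  apply: le_trans e1; apply: (@le_trans _ _ (kap / 2 * `|T|)); last by apply: ler_wpM2l; lra.
  have k2 : 0 <= kap / 2 by lra.
  have := ler_wpM2l k2 ht; have := ler_wpM2r (ltW M0) c4a; lra.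
have [s s1 sT] : exists2 s : R, s = 1 \/ s = -1 & s * T = `|T|.
  have [T0'|T0'] := leP 0 T.
    by exists 1; [left | rewrite mul1r ger0_norm].
  by exists (-1); [right | rewrite mulN1r ltr0_norm].
exists s => //; split => //.
  suff -> : sg * s * h1 P = `|h1 P| by [].
  have TE : T = s * `|T| by rewrite -sT; case: s1 => ->; ring.
  have pos : 0 < sg * s * h1 P.
    rewrite TE in sgn; rewrite -(pmulr_lgt0 _ T0).
    by have -> : sg * s * h1 P * `|T| = sg * h1 P * (s * `|T|) by ring.
  have n1 : `|sg * s| = 1.
    by case: (pp_sg pp) => ->; case: s1 => ->; rewrite normrM ?normrN ?normr1 mulr1.
  by rewrite -(gtr0_norm pos) normrM n1 mul1r.
have /andP[wm _] := pp_w1 pp Pv.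
rewrite (eig2E pp DP) -/T.
have -> : - s * ((u1 (enorm2 P) - w1 (enorm2 (P - v))) / enorm2 P
     - w1 (enorm2 (P - v)) * T / (enorm2 P * enorm2 (P - v))) =
   w1 (enorm2 (P - v)) * `|T| / (enorm2 P * enorm2 (P - v))
   - s * (u1 (enorm2 P) - w1 (enorm2 (P - v))) / enorm2 P.
  by rewrite -sT; field; rewrite !gt_eqF.
(* Both radii are at most 2, hence the 4. *)
have a1 : m0 * `|T| / 4 <= w1 (enorm2 (P - v)) * `|T| / (enorm2 P * enorm2 (P - v)).
  apply: ler_pM; rewrite ?mulr_ge0 ?invr_ge0 ?(ltW m00) ?(ltW T0)//.
    by apply: ler_wpM2r => //; exact: ltW.
  rewrite lef_pV2 ?posrE ?mulr_gt0//.
  by apply: (@le_trans _ _ (2 * 2)); [apply: ler_pM => //; exact: ltW | lra].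
have a2 : s * (u1 (enorm2 P) - w1 (enorm2 (P - v))) / enorm2 P <= c2 * M.
  rewrite ler_pdivrMr//; apply: (@le_trans _ _ (c2 * M)).
    by move: h; rewrite ler_norml => /andP[? ?]; case: s1 => ->; lra.
  by apply: ler_peMr => //; apply: mulr_ge0; exact: ltW.
have := ler_wpM2l (ltW m00) ht; have := ler_wpM2r (ltW M0) c2c.
by have := ler_wpM2r (ltW M0) c4b; lra.
Qed.

Let err_le P Z Z' : nearcrit c2 P ->
  4 * L * enorm2 (dir P - dir (P - v)) * (enorm2 Z * enorm2 Z')
  <= c4 / 8 * M * (enorm2 Z * enorm2 Z').
Proof.
move=> nP; have [_ h] := nearcrit_dir nP.
apply: ler_wpM2r; first by rewrite mulr_ge0 ?enorm2_ge0.
have m00 := pp_m0 pp; have L1 := pp_L pp.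
rewrite -(ler_pM2l m00).
have L4 : 0 <= 4 * L by lra.
by have := ler_wpM2l L4 h; have := ler_wpM2r (ltW M0) c2d; lra.
Qed.

Lemma elliptic_hess P : sg = -1 -> nearcrit c2 P ->
  exists2 s : R, s = 1 \/ s = -1 & s * tau P = `|tau P| /\
    forall Z, c4 / 2 * M * enorm2 Z ^+ 2 <= - s * hess u1 u2 w1 w2 v P Z Z.
Proof.
move=> sgE nP; have [s s1 [sT a1 a2]] := nearcrit_sign nP.
exists s => //; split => // Z; have [DP _] := nP.
have [r1 _] := dom_ge1 pp DP; have r0 := lt_le_trans ltr01 r1.
have := le_trans (hess_approx pp Z Z DP) (err_le Z Z nP).
rewrite -!expr2.
have := dot_unit_le Z (unit_dir r0); rewrite -/(dir P).
rewrite -ler_sqr ?nnegrE ?enorm2_ge0// real_normK ?num_real// => q1.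
rewrite -enorm2_sqr.
set q := dot (dir P) Z ^+ 2 in q1 *; have q0 : 0 <= q by exact: sqr_ge0.
set z := enorm2 Z ^+ 2 in q1 *; set H := hess _ _ _ _ _ _ _ _.
rewrite sgE in a1 => h.
have b1 := ler_wpM2r q0 a1.
have qz : 0 <= z - q by lra.
have b2 := ler_wpM2r qz a2.
have z0 : 0 <= c4 * M * z by apply: mulr_ge0; [apply: mulr_ge0; exact: ltW | exact: sqr_ge0].
by move: h; rewrite ler_norml => /andP[? ?]; case: s1 b1 b2 => ->; lra.
Qed.

(** If n0 were dir P, the approximate Hessian of Z and its reflection would be h1 (n.Z)^2 - h2
    (|Z|^2 - (n.Z)^2), definite since h1 and h2 have opposite signs. The axis [n0] is separate from
    [P] because [grad_mvt] requires a multiplier that is constant along the segment. *)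
Lemma hyperbolic_hess P n0 : sg = 1 -> nearcrit c2 P -> enorm2 n0 = 1 ->
  24 * L * enorm2 (dir P - n0) <= c4 ->
  forall Z, c4 / 2 * M * enorm2 Z ^+ 2 <=
    `|hess u1 u2 w1 w2 v P Z (sc (2 * dot n0 Z) n0 - Z)|.
Proof.
move=> sgE nP n01 hn Z; have [s s1 [_ a1 a2]] := nearcrit_sign nP.
have [DP _] := nP.
have [r1 _] := dom_ge1 pp DP; have r0 := lt_le_trans ltr01 r1.
have nn0 : dot n0 n0 = 1 by rewrite -enorm2_sqr n01 expr1n.
set Z' := sc _ _ - Z.
have Z'Z : enorm2 Z' = enorm2 Z by exact: enorm2_reflect.
have n0Z' : dot n0 Z' = dot n0 Z.
  have -> : dot n0 Z' = 2 * dot n0 Z * dot n0 n0 - dot n0 Z.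
    by rewrite /Z' /dot /=; ring.
  by rewrite nn0; ring.
have ZZ' : dot Z Z' = 2 * dot n0 Z ^+ 2 - enorm2 Z ^+ 2.
  by rewrite enorm2_sqr /Z' /dot /=; ring.
have := le_trans (hess_approx pp Z Z' DP) (err_le Z Z' nP).
have := dot_unit_diff Z Z' (unit_dir r0) n01; rewrite -/(dir P).
rewrite Z'Z ZZ' n0Z' -!expr2.
have := dot_unit_le Z n01.
rewrite -ler_sqr ?nnegrE ?enorm2_ge0// real_normK ?num_real// => q1.
set q := dot n0 Z ^+ 2 in q1 *; have q0 : 0 <= q by exact: sqr_ge0.
set z := enorm2 Z ^+ 2 in q1 *; set H := hess _ _ _ _ _ _ _ _.
set x := dot (dir P) Z * dot (dir P) Z'.
have z0 : 0 <= z by exact: sqr_ge0.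
move=> hx h; rewrite sgE mul1r in a1.
have b1 := ler_wpM2r q0 a1.
have qz : 0 <= z - q by lra.
have b2 := ler_wpM2r qz a2.
have L1 := pp_L pp.
have LM : 0 <= L * M by apply: mulr_ge0; [lra | exact: ltW].
have hx1 : `|(h1 P - h2 P) * (x - q)| <= c4 / 4 * M * z.
  rewrite normrM; apply: (@le_trans _ _ ((3 * L * M) * (2 * enorm2 (dir P - n0) * z))).
    apply: ler_pM => //; apply: (le_trans (ler_normB _ _)).
    by have := eig1_le pp DP; have := eig2_le pp DP; lra.
  have := ler_wpM2r (mulr_ge0 (ltW M0) z0) hn; lra.
have cz : 0 <= c4 * M * z by apply: mulr_ge0 => //; apply: mulr_ge0; exact: ltW.
apply: (@le_trans _ _ (s * H)); last first.
  by case: s1 => ->; rewrite ?mul1r ?mulN1r; [exact: ler_norm | rewrite -normrN; exact: ler_norm].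
move: h hx1; rewrite !ler_norml => /andP[? ?] /andP[? ?].
by case: s1 b1 b2 => ->; lra.
Qed.

(* Both [sc (tau P) (dir P)] and [sc (tau P0) (dir P0)] are close to [v]. *)
Lemma nearcrit_tau_sign P P0 : nearcrit c2 P -> nearcrit c2 P0 ->
  0 <= dot (dir P) (dir P0) -> 0 < tau P * tau P0.
Proof.
move=> nP nP0 hd.
have [[r1 _] [r1' _]] := (dom_ge1 pp (proj1 nP), dom_ge1 pp (proj1 nP0)).
have d1 : dot (dir P) (dir P) = 1.
  by rewrite -enorm2_sqr unit_dir ?expr1n// (lt_le_trans ltr01).
have d0 : dot (dir P0) (dir P0) = 1.
  by rewrite -enorm2_sqr unit_dir ?expr1n// (lt_le_trans ltr01).
have hv := nearcrit_shift nP; have hv0 := nearcrit_shift nP0.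
have ht := nearcrit_tau nP; have ht0 := nearcrit_tau nP0.
have m00 := pp_m0 pp.
(* Opposite signs, with directions at no obtuse angle, would put the two vectors at least c3 M
   apart. *)
rewrite ltNge; apply/negP => hneg.
have e1 : enorm2 (sc (tau P) (dir P) - sc (tau P0) (dir P0)) <= c3 / 2 * M.
  have := enorm2D (v - sc (tau P0) (dir P0)) (- (v - sc (tau P) (dir P))).
  rewrite enorm2N opprB addrC addrA subrK => e.
  rewrite -(ler_pM2l m00); have := ler_wpM2l (ltW m00) e; rewrite mulrDr.
  by have := ler_wpM2r (ltW M0) c2c; lra.
have c3M : 0 < c3 * M by rewrite mulr_gt0.
have e2 : enorm2 (sc (tau P) (dir P) - sc (tau P0) (dir P0)) ^+ 2 <= (c3 / 2 * M) ^+ 2.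
  by rewrite ler_sqr ?nnegrE ?enorm2_ge0//; lra.
have e3 : enorm2 (sc (tau P) (dir P) - sc (tau P0) (dir P0)) ^+ 2 =
   tau P ^+ 2 + tau P0 ^+ 2 - 2 * (tau P * tau P0) * dot (dir P) (dir P0).
  rewrite enorm2_sqr.
  have -> : dot (sc (tau P) (dir P) - sc (tau P0) (dir P0))
      (sc (tau P) (dir P) - sc (tau P0) (dir P0)) =
    tau P ^+ 2 * dot (dir P) (dir P) + tau P0 ^+ 2 * dot (dir P0) (dir P0)
    - 2 * (tau P * tau P0) * dot (dir P) (dir P0) by rewrite /dot /=; ring.
  by rewrite d1 d0 !mulr1.
have e4 : (c3 * M) ^+ 2 <= tau P ^+ 2.
  rewrite -[tau P ^+ 2]real_normK ?num_real// ler_sqr ?nnegrE//; exact: ltW.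
have e5 := mulr_le0_ge0 hneg hd.
have e6 := sqr_ge0 (tau P0).
have e7 : 0 < (c3 * M) ^+ 2 by exact: exprn_gt0.
have e8 : (c3 / 2 * M) ^+ 2 = (c3 * M) ^+ 2 / 4 by field.
lra.
Qed.

End NearCritical.

(** * Mean value estimates for the gap along segments *)

Section Segments.
Context {R : realType} {t0 t1 L m0 l1 kap cs sg Dl : R}.
Context {u u1 u2 w w1 w2 : R -> R}.
Context (pp : profile_pair t0 t1 L m0 l1 kap cs sg Dl u u1 u2 w w1 w2).
Context {v : R * R}.
Implicit Types (X Y P Z : R * R).

Local Notation M := (Dl + enorm2 v).
Local Notation D := (dom t0 t1 v).
Local Notation F := (gap u w v).
Local Notation dF := (grad u1 w1 v).
Local Notation ddF := (hess u1 u2 w1 w2 v).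

Lemma dotBl X Y Z : dot (X - Y) Z = dot X Z - dot Y Z.
Proof. by rewrite /dot /=; ring. Qed.

Definition segdom t0 t1 v X Y : Prop :=
  forall s : R, 0 <= s <= 1 -> dom t0 t1 v (line X (Y - X) s).

Lemma line0 X Z : line X Z 0 = X.
Proof. by case: X => x y; rewrite /line /sc !mul0r; apply/eqP; rewrite xpair_eqE /= !addr0 !eqxx. Qed.

Lemma line1 X Y : line X (Y - X) 1 = Y.
Proof. by case: X => x y; case: Y => a b; rewrite /line /sc !mul1r; apply/eqP; rewrite xpair_eqE /= !subrKC !eqxx. Qed.

Lemma lineB X Z s v' : line X Z s - v' = line (X - v') Z s.
Proof. by rewrite /line addrAC. Qed.

Lemma segdom_line X Y s : segdom t0 t1 v X Y -> 0 <= s <= 1 ->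
  segdom t0 t1 v X (line X (Y - X) s).
Proof.
move=> h /andP[s0 s1] r /andP[r0 r1].
have -> : line X (line X (Y - X) s - X) r = line X (Y - X) (r * s).
  by apply/eqP; rewrite xpair_eqE /=; apply/andP; split; apply/eqP; ring.
by apply: h; rewrite mulr_ge0//= mulr_ile1.
Qed.

(** Convexity of the norm bounds the radii from above. An annulus is not convex, so the lower bound
    uses that the segment is short: a radius starts at [j0] or more and drops by at most [d]. *)
Lemma segdom_annulus X Y (j0 j1 d : R) : j1 < t1 -> t0 + d < j0 ->
  enorm2 (Y - X) <= d ->
  j0 <= enorm2 X -> j0 <= enorm2 (X - v) ->
  enorm2 X <= j1 -> enorm2 (X - v) <= j1 ->
  enorm2 Y <= j1 -> enorm2 (Y - v) <= j1 ->
  segdom t0 t1 v X Y.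
Proof.
move=> j1t j0t dXY a1 a2 b1 b2 b3 b4 s /andP[s0 s1].
have aux X' Y' : enorm2 (Y' - X') <= d -> j0 <= enorm2 X' -> enorm2 X' <= j1 ->
    enorm2 Y' <= j1 -> t0 < enorm2 (line X' (Y' - X') s) < t1.
  move=> dd c1 c2 c3; apply/andP; split.
    have := enorm2D (line X' (Y' - X') s) (- sc s (Y' - X')).
    rewrite enorm2N /line addrK enorm2_sc (ger0_norm s0).
    have : s * enorm2 (Y' - X') <= d.
      by apply: le_trans dd; apply: ler_piMl => //; exact: enorm2_ge0.
    lra.
  have -> : line X' (Y' - X') s = sc (1 - s) X' + sc s Y'.
    by apply/eqP; rewrite xpair_eqE /=; apply/andP; split; apply/eqP; ring.
  apply: (le_lt_trans (enorm2D _ _)); rewrite !enorm2_sc !ger0_norm ?subr_ge0//.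
  apply: le_lt_trans j1t.
  have s1' : 0 <= 1 - s by lra.
  have := ler_wpM2l s0 c3; have := ler_wpM2l s1' c2; lra.
split; first exact: aux.
rewrite lineB; have -> : Y - X = (Y - v) - (X - v) by rewrite opprB addrA subrK.
by apply: aux => //; rewrite opprB addrA subrK.
Qed.

Lemma grad_mvt X Y Z' : segdom t0 t1 v X Y ->
  exists2 s, 0 < s < 1 & dot (dF Y - dF X) Z' = ddF (line X (Y - X) s) (Y - X) Z'.
Proof.
move=> h.
have [|s s01 e] := @MVT01 R (fun s => dot (dF (line X (Y - X) s)) Z')
   (fun s => ddF (line X (Y - X) s) (Y - X) Z'); last first.
  exists s => //; rewrite -e line0 line1 /dot /=; ring.
move=> s /h hs; have [r1 r2] := dom_ge1 pp hs; have [Pu Pv] := hs.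
have r0 := lt_le_trans ltr01 r1; have r0' := lt_le_trans ltr01 r2.
rewrite lineB in r0' Pv.
have d1 := is_derive_grad_line Z' r0 (pp_du1 pp Pu).
have d2 := is_derive_grad_line Z' r0' (pp_dw1 pp Pv).
have d3 := is_deriveB d1 d2.
rewrite (_ : (fun s => _) = (fun s => dot (grad_radial u1 (line X (Y - X) s)) Z')
   - (fun s => dot (grad_radial w1 (line (X - v) (Y - X) s)) Z')).
  by apply: (is_derive_eq d3); rewrite /hess lineB.
by apply/funext => x; rewrite !fctE /grad -lineB /dot /=; ring.
Qed.

Lemma is_derive_gap X Y (s : R) : segdom t0 t1 v X Y -> 0 <= s <= 1 ->
  is_derive s 1 (fun s => F (line X (Y - X) s)) (dot (dF (line X (Y - X) s)) (Y - X)).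
Proof.
move=> h /h hs; have [r1 r2] := dom_ge1 pp hs; have [Pu Pv] := hs.
have r0 := lt_le_trans ltr01 r1; have r0' := lt_le_trans ltr01 r2.
rewrite lineB in r0' Pv.
have d1 := is_derive_radial_line r0 (pp_du pp Pu).
have d2 := is_derive_radial_line r0' (pp_dw pp Pv).
have d3 := is_deriveB d1 d2.
rewrite (_ : (fun s => _) = (fun s => u (enorm2 (line X (Y - X) s)))
   - (fun s => w (enorm2 (line (X - v) (Y - X) s)))).
  by apply: (is_derive_eq d3); rewrite /grad lineB /dot /=; ring.
by apply/funext => x; rewrite !fctE /gap -lineB.
Qed.

Lemma M_gt0 : 0 < M.
Proof. by have := pp_Dl pp; have := enorm2_ge0 v; lra. Qed.

Lemma grad_lipschitz X Y : segdom t0 t1 v X Y ->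
  enorm2 (dF Y - dF X) <= 13 * L * M * enorm2 (Y - X).
Proof.
(* The increment of the gradient is its own test vector. *)
move=> h; have [s /andP[s0 s1] e] := grad_mvt (dF Y - dF X) h.
have s01 : 0 <= s <= 1 by rewrite !ltW.
have := hess_le pp (Y - X) (dF Y - dF X) (h s s01).
rewrite -e -enorm2_sqr => hh.
set G := enorm2 (dF Y - dF X) in hh *; have G0 : 0 <= G by exact: enorm2_ge0.
have [->|Gn0] := eqVneq G 0.
  have L1 := pp_L pp; have M0 := M_gt0; have := enorm2_ge0 (Y - X).
  by move=> ?; rewrite mulr_ge0// mulr_ge0 ?(ltW M0)//; lra.
have Gp : 0 < G by rewrite lt_neqAle eq_sym Gn0.
rewrite -(ler_pM2r Gp); apply: le_trans (le_trans (ler_norm _) hh) _ => //.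
by rewrite mulrA.
Qed.

Lemma gap_quadratic X Y : segdom t0 t1 v X Y ->
  `|F Y - F X - dot (dF X) (Y - X)| <= 13 * L * M * enorm2 (Y - X) ^+ 2.
Proof.
move=> h.
have [s s01] := MVT01 (fun s (s01 : 0 <= s <= 1) => is_derive_gap h s01).
rewrite line0 line1 => ->.
have [s0 s1] : 0 <= s /\ s <= 1 by case/andP: s01; split; exact: ltW.
have s01' : 0 <= s <= 1 by rewrite s0.
have := grad_lipschitz (segdom_line h s01').
set P := line X (Y - X) s => g.
have -> : dot (dF P) (Y - X) - dot (dF X) (Y - X) = dot (dF P - dF X) (Y - X).
  by rewrite /dot /=; ring.
apply: (le_trans (dot_le _ _)); rewrite expr2 mulrA.
apply: ler_wpM2r; first exact: enorm2_ge0.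
apply: (le_trans g); apply: ler_wpM2l.
  by have := pp_L pp; have := M_gt0; nra.
have -> : P - X = sc s (Y - X) by rewrite /P /line addrC addKr.
by rewrite enorm2_sc (ger0_norm s0); apply: ler_piMl => //; exact: enorm2_ge0.
Qed.

Lemma gap_convex X Y (o c : R) : segdom t0 t1 v X Y ->
  (forall s : R, 0 <= s <= 1 ->
     c * enorm2 (Y - X) ^+ 2 <= o * ddF (line X (Y - X) s) (Y - X) (Y - X)) ->
  dot (sc o (dF X)) (Y - X) + c / 2 * enorm2 (Y - X) ^+ 2 <= o * F Y - o * F X.
Proof.
move=> h hc; set Z := Y - X in hc *; set z := enorm2 Z ^+ 2 in hc *.
(* Subtracting the tangent and the quadratic term leaves a function whose derivative is nonnegative,
   by a second mean value argument. *)
have d (s : R) : 0 <= s <= 1 -> is_derive s 1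
    (fun s => o * F (line X Z s) - o * dot (dF X) Z * s - c / 2 * z * s ^+ 2)
    (o * dot (dF (line X Z s) - dF X) Z - c * s * z).
  move=> s01; have d1 := is_derive_gap h s01; rewrite -/Z in d1.
  apply: is_derive_eq.
  rewrite /GRing.scale /= dotBl; set x := dot _ _; set y := dot _ _; by field.
have [s /andP[s0 s1]] := MVT01 d.
rewrite /Z line0 line1 -/Z => e.
have s01' : 0 <= s <= 1 by rewrite !ltW.
have [r /andP[r0 r1] e'] := grad_mvt Z (segdom_line h s01').
rewrite -/Z in e'.
have PX : line X Z s - X = sc s Z by rewrite /line addrC addKr.
have lr : line X (line X Z s - X) r = line X Z (r * s).
  by rewrite PX; apply/eqP; rewrite xpair_eqE /=; apply/andP; split; apply/eqP; ring.
rewrite lr PX in e'.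
have rs : 0 <= r * s <= 1 by rewrite mulr_ge0 ?mulr_ile1 ?ltW.
have := hc _ rs.
have e2 : ddF (line X Z (r * s)) (sc s Z) Z = s * ddF (line X Z (r * s)) Z Z.
  by rewrite /hess /hess_radial /dot /=; ring.
rewrite e2 in e'; rewrite e' in e => hcs.
have := ler_wpM2l (ltW s0) hcs.
have -> : dot (sc o (dF X)) Z = o * dot (dF X) Z by rewrite /dot /=; ring.
move: e; set HH := ddF _ _ _ => e; lra.
Qed.

End Segments.

(** * The sublevel set on one small square *)

Section Patch.
Context {R : realType} {t0 t1 L m0 l1 kap cs sg Dl : R}.
Context {u u1 u2 w w1 w2 : R -> R}.
Context (pp : profile_pair t0 t1 L m0 l1 kap cs sg Dl u u1 u2 w w1 w2).
Context {v : R * R}.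
Context {c2 c3 c4 : R}.
Context (c20 : 0 < c2) (c30 : 0 < c3) (c40 : 0 < c4).
Context (c2a : 2 * c2 * (m0 + 2 * l1) <= l1 * m0).
Context (c3E : 2 * c3 * (L + l1) <= l1).
Context (c2b : c2 <= c3 * cs).
Context (c2c : 8 * c2 <= m0 * c3).
Context (c4a : 2 * c4 <= kap * c3).
Context (c4b : 8 * c4 <= m0 * c3).
Context (c2d : 32 * L * c2 <= m0 * c4).
Context {ep : R} (ep0 : 0 < ep) (epa : 832 * L * ep <= c2)
  (epb : 96 * L * ep <= c4) (epc : 8 * ep <= 1).
Context {S : set (R * R)} {q : R * R} {ta e : R}.
Context (e0 : 0 < e) (Sq : S `<=` box (q, (ep, ep))).
Context (Sseg : forall X Y, S X -> S Y -> segdom t0 t1 v X Y).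
Context (Se : forall X, S X -> `|gap u w v X - ta| <= e).
Implicit Types (X Y P Z : R * R).

Local Notation M := (Dl + enorm2 v).
Local Notation F := (gap u w v).
Local Notation dF := (grad u1 w1 v).
Local Notation ddF := (hess u1 u2 w1 w2 v).
Local Notation tau P := (enorm2 P - enorm2 (P - v)).
Local Notation nearcrit := (@nearcrit R t0 t1 Dl u1 w1 v).

Let M0 : 0 < M.
Proof. by have := pp_Dl pp; have := enorm2_ge0 v; lra. Qed.

Let L0 : 0 < L. Proof. by have := pp_L pp; lra. Qed.

(** Division by M makes the C^{1,1} constant independent of the parameters and of the
    translation. *)
Let quad (o : R) : `|o| = M^-1 ->
  quad_approx S (fun X => o * (F X - ta)) (fun X => sc o (dF X)) (13 * L).
Proof.
move=> oE X Y SX SY; have seg := Sseg SX SY; split.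
  have -> : o * (F Y - ta) - o * (F X - ta) - dot (sc o (dF X)) (Y - X) =
     o * (F Y - F X - dot (dF X) (Y - X)) by rewrite /dot /=; ring.
  rewrite normrM oE ler_pdivrMl//; have := gap_quadratic pp seg; lra.
have -> : sc o (dF Y) - sc o (dF X) = sc o (dF Y - dF X).
  by apply/eqP; rewrite xpair_eqE /=; apply/andP; split; apply/eqP; ring.
rewrite enorm2_sc oE ler_pdivrMl//; have := grad_lipschitz pp seg; lra.
Qed.

Let small (o : R) : `|o| = M^-1 -> forall X, S X -> `|o * (F X - ta)| <= e / M.
Proof.
by move=> oE X SX; rewrite normrM oE mulrC ler_pM2r ?invr_gt0//; exact: Se.
Qed.

Let flat (o : R) : `|o| = M^-1 -> forall p, S p -> c2 / 2 * M <= enorm2 (dF p) ->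
  covered S (64 * ep / c2 * (e / M)).
Proof.
move=> oE p Sp hp.
have -> : 64 * ep / c2 * (e / M) = 32 * ep * (e / M) / (c2 / 2).
  by field; rewrite !gt_eqF.
have eM : 0 < e / M by rewrite divr_gt0.
apply: (area_cell ep0 eM _ _ _ Sq Sp _ (quad oE) (small oE)).
- by rewrite divr_gt0.
- by rewrite mulr_ge0// ltW.
- by have := epa; lra.
- by rewrite enorm2_sc oE ler_pdivlMl// mulrC.
Qed.

Let seg_dist X Y (s : R) : S X -> S Y -> 0 <= s <= 1 ->
  enorm2 (line X (Y - X) s - X) <= 2 * ep.
Proof.
move=> SX SY /andP[s0 s1]; rewrite /line addrC addKr enorm2_sc (ger0_norm s0).
apply: le_trans (box_diam (Sq SY) (Sq SX)).
by apply: ler_piMl => //; exact: enorm2_ge0.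
Qed.

(** Within the patch the gradient varies by at most 26 L ep M, far less than (c2 / 2) M. *)
Let crit : ~ (exists p, S p /\ c2 / 2 * M <= enorm2 (dF p)) ->
  forall X Y (s : R), S X -> S Y -> 0 <= s <= 1 -> nearcrit c2 (line X (Y - X) s).
Proof.
move=> ng X Y s SX SY s01; split; first exact: Sseg.
have hX : enorm2 (dF X) <= c2 / 2 * M.
  by rewrite leNgt; apply/negP => /ltW h; apply: ng; exists X.
have := enorm2D (dF (line X (Y - X) s) - dF X) (dF X); rewrite subrK => h.
have g := grad_lipschitz pp (segdom_line (Sseg SX SY) s01).
have d := seg_dist SX SY s01.
have LM : 0 <= 13 * L * M by rewrite !mulr_ge0// ltW.
have := ler_wpM2l LM d; have := ler_wpM2r (ltW M0) epa.
have := mulr_gt0 c20 M0; lra.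
Qed.

Let dir_seg X Y (s : R) : S X -> S Y -> 0 <= s <= 1 ->
  enorm2 (dir (line X (Y - X) s) - dir X) <= 4 * ep.
Proof.
move=> SX SY s01.
have [r1 _] := dom_ge1 pp (Sseg SX SY s01).
have h0 : (0 : R) <= (0 : R) <= 1 by apply/andP; split; lra.
have [] := dom_ge1 pp (Sseg SX SY h0); rewrite line0 => r1' _.
by apply: (le_trans (unit_dir_dist r1 r1')); have := seg_dist SX SY s01; lra.
Qed.

Let oM : `|M^-1| = M^-1.
Proof. by rewrite ger0_norm// invr_ge0 ltW. Qed.

Let flat_or_crit (A : R) : 64 * ep / c2 * (e / M) <= A ->
  ((exists p, S p) -> (forall X Y (s : R), S X -> S Y -> 0 <= s <= 1 -> nearcrit c2 (line X (Y - X) s)) ->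
    covered S A) -> covered S A.
Proof.
move=> hA hc.
have [[p [Sp hp]]|ng] := pselect (exists p, S p /\ c2 / 2 * M <= enorm2 (dF p)).
  exact: covered_sub hA (flat oM Sp hp).
have [Sn|Sn] := pselect (exists p, S p); first exact: hc Sn (crit ng).
apply: covered0; last by move=> X SX; apply: Sn; exists X.
by apply: le_trans hA; rewrite !mulr_ge0 ?invr_ge0 ?(ltW c20) ?(ltW ep0) ?(ltW e0) ?(ltW M0).
Qed.

Lemma hyperbolic_patch k n : sg = 1 -> 256 * (13 * L) <= c4 / 2 * k.+1%:R ->
  covered S ((64 * ep / c2 + n%:R * (k.+1%:R ^+ 2 / (13 * L))) * (e / M)
             + (ep / 2 ^+ n) ^+ 2).
Proof.
move=> sgE kC.
have eM : 0 < e / M by rewrite divr_gt0.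
have a1 : 0 <= n%:R * (k.+1%:R ^+ 2 / (13 * L)) * (e / M).
  have L13 : 0 <= 13 * L by rewrite mulr_ge0// ltW.
  apply: mulr_ge0 (ltW eM); apply: mulr_ge0 => //; apply: divr_ge0 => //; exact: sqr_ge0.
have a2 : 0 <= 64 * ep / c2 * (e / M).
  by rewrite !mulr_ge0 ?invr_ge0 ?(ltW c20) ?(ltW ep0) ?(ltW e0) ?(ltW M0).
have a3 := sqr_ge0 (ep / 2 ^+ n).
apply: flat_or_crit => [|_ cr]; first lra.
apply: (@covered_sub _ _ S (n%:R * (k.+1%:R ^+ 2 * (e / M / (13 * L))) + (ep / 2 ^+ n) ^+ 2)) => //.
  have -> : n%:R * (k.+1%:R ^+ 2 * (e / M / (13 * L))) =
     n%:R * (k.+1%:R ^+ 2 / (13 * L)) * (e / M) by ring.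
  lra.
apply: (@area_log _ S _ _ (13 * L) (c4 / 2) (e / M) ep q k n ep0 eM _ _ kC Sq (quad oM) _ (small oM)).
- by rewrite mulr_gt0.
- by rewrite divr_gt0.
move=> X Y SX SY.
have -> : sc M^-1 (dF Y) - sc M^-1 (dF X) = sc M^-1 (dF Y - dF X).
  by apply/eqP; rewrite xpair_eqE /=; apply/andP; split; apply/eqP; ring.
rewrite enorm2_sc oM ler_pdivlMl//.
set Z := Y - X.
have [Z0|Zn] := eqVneq (enorm2 Z) 0; first by rewrite Z0 !mulr0 enorm2_ge0.
have Zp : 0 < enorm2 Z by rewrite lt_neqAle eq_sym Zn enorm2_ge0.
have h0 : (0 : R) <= (0 : R) <= 1 by apply/andP; split; lra.
have [] := dom_ge1 pp (Sseg SX SY h0); rewrite line0 => r1 _.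
have n1 : enorm2 (dir X) = 1 by apply: unit_dir; exact: lt_le_trans ltr01 r1.
(* The axis is the direction at the endpoint [X]; along the segment directions change by at most 4
   ep, within the tolerance of [hyperbolic_hess]. *)
pose Z' := sc (2 * dot (dir X) Z) (dir X) - Z.
have [s /andP[s0 s1] eH] := grad_mvt pp Z' (Sseg SX SY).
have s01 : 0 <= s <= 1 by rewrite !ltW.
have hn : 24 * L * enorm2 (dir (line X (Y - X) s) - dir X) <= c4.
  have := dir_seg SX SY s01 => d; have L24 : 0 <= 24 * L by rewrite mulr_ge0// ltW.
  have := ler_wpM2l L24 d; have := epb; lra.
have := hyperbolic_hess pp c20 c30 c40 c2a c3E c2b c2c c4a c4b c2d sgE (cr X Y s SX SY s01) n1 hn Z.
rewrite -/Z' -eH => hh.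
have := le_trans hh (dot_le _ _); rewrite enorm2_reflect// expr2 mulrA ler_pM2r//.
by apply: le_trans; lra.
Qed.

Lemma elliptic_patch k : sg = -1 -> 512 * (13 * L) <= c4 / 2 * k.+1%:R ->
  covered S ((64 * ep / c2 + 512 * k.+1%:R / (c4 / 2)) * (e / M)).
Proof.
move=> sgE kC.
have eM : 0 < e / M by rewrite divr_gt0.
have a1 : 0 <= 512 * k.+1%:R / (c4 / 2) * (e / M).
  apply: mulr_ge0; last exact: ltW.
  by apply: divr_ge0; [apply: mulr_ge0; exact: ler0n | rewrite divr_ge0// ltW].
have a2 : 0 <= 64 * ep / c2 * (e / M).
  by rewrite !mulr_ge0 ?invr_ge0 ?(ltW c20) ?(ltW ep0) ?(ltW e0) ?(ltW M0).
apply: flat_or_crit => [|[p0 Sp0] cr]; first lra.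
apply: (@covered_sub _ _ S (512 * k.+1%:R * (e / M) / (c4 / 2))) => //.
  have -> : 512 * k.+1%:R * (e / M) / (c4 / 2) = 512 * k.+1%:R / (c4 / 2) * (e / M) by ring.
  lra.
have h0 : (0 : R) <= (0 : R) <= 1 by apply/andP; split; lra.
have np0 : nearcrit c2 p0 by have := cr p0 p0 0 Sp0 Sp0 h0; rewrite line0.
have [s s1 [sT _]] := elliptic_hess pp c20 c30 c40 c2a c3E c2b c2c c4a c4b c2d sgE np0.
(* The choice between convex and concave is made at the single point [p0]; [nearcrit_tau_sign] shows
   that it is right on the whole patch. *)
pose o := - s / M.
have oE : `|o| = M^-1.
  by rewrite /o normrM oM; case: s1 => ->; rewrite ?opprK ?normrN normr1 mul1r.
apply: (@area_convex _ S _ _ (13 * L) (c4 / 2) (e / M) k eM _ _ kC (quad oE) _ (small oE)).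
- by rewrite mulr_gt0.
- by rewrite divr_gt0.
move=> X Y SX SY.
have -> : o * (F Y - ta) - o * (F X - ta) = o * F Y - o * F X by ring.
apply: (gap_convex pp (Sseg SX SY)) => r r01.
have nP := cr X Y r SX SY r01; set P := line X (Y - X) r in nP *.
have [s' s1' [sT' hP]] := elliptic_hess pp c20 c30 c40 c2a c3E c2b c2c c4a c4b c2d sgE nP.
have [[r1 _] [r1' _]] := (dom_ge1 pp (proj1 nP), dom_ge1 pp (proj1 np0)).
have hd : 0 <= dot (dir P) (dir p0).
  (* Two changes of direction of at most 4 ep each; unit vectors at distance at most 1 have inner
     product at least 1/2. *)
  have hh : enorm2 (dir P - dir p0) <= 1.
    have := dir_seg SX SY r01; rewrite -/P => d1.
    have h1 : (0 : R) <= (1 : R) <= 1 by apply/andP; split; lra.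
    have := dir_seg Sp0 SX h1; rewrite line1 => d2.
    have := enorm2D (dir P - dir X) (dir X - dir p0); rewrite addrA subrK.
    by have := epc; lra.
  have d1 : dot (dir P) (dir P) = 1.
    by rewrite -enorm2_sqr unit_dir ?expr1n// (lt_le_trans ltr01).
  have d0 : dot (dir p0) (dir p0) = 1.
    by rewrite -enorm2_sqr unit_dir ?expr1n// (lt_le_trans ltr01).
  have : enorm2 (dir P - dir p0) ^+ 2 <= 1 by rewrite expr_le1// enorm2_ge0.
  rewrite enorm2_sqr.
  have -> : dot (dir P - dir p0) (dir P - dir p0) =
    dot (dir P) (dir P) + dot (dir p0) (dir p0) - 2 * dot (dir P) (dir p0).
    by rewrite /dot /=; ring.
  rewrite d1 d0; lra.
have tt := nearcrit_tau_sign pp c20 c30 c2a c3E c2c nP np0 hd.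
have ss : s' = s.
  have p1 : 0 <= s' * tau P by rewrite sT'.
  have p2 : 0 <= s * tau p0 by rewrite sT.
  have := mulr_ge0 p1 p2; case: s1 => ->; case: s1' => -> //; nra.
have := hP (Y - X); rewrite ss /o; set H := hess _ _ _ _ _ _ _ _ => hh.
have -> : - s / M * H = (- s * H) / M by ring.
by rewrite ler_pdivlMr//; lra.
Qed.

End Patch.

(** * Area of the planar sublevel set *)

Section PlanarArea.
Context {R : realType}.

Definition sublevel (u w : R -> R) (v : R * R) (j0 j1 ta e : R) : set (R * R) :=
  [set X | [/\ j0 <= enorm2 X <= j1, j0 <= enorm2 (X - v) <= j1
             & `|gap u w v X - ta| <= e]].

Lemma ex_natr_ge (x : R) : exists k : nat, x <= k.+1%:R.
Proof.
exists (Num.bound `|x|); apply: (le_trans (ler_norm x)).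
have /ltW/le_trans := archi_boundP (normr_ge0 x); apply.
by rewrite ler_nat.
Qed.

Lemma ex_le4 (a b c d : R) : 0 < a -> 0 < b -> 0 < c -> 0 < d ->
  exists2 x : R, 0 < x & [/\ x <= a, x <= b, x <= c & x <= d].
Proof.
move=> a0 b0 c0 d0; exists (Num.min (Num.min a b) (Num.min c d)).
  by rewrite !lt_min a0 b0 c0.
by split; rewrite !ge_min lexx ?orbT.
Qed.

Lemma sublevel_sub_box u w v j0 j1 ta e : j1 <= 2 ->
  sublevel u w v j0 j1 ta e `<=` box ((-2, -2), (4, 4)).
Proof.
move=> j12 X [/andP[_ h] _ _].
have := le_enorm2_fst X; have := le_enorm2_snd X.
rewrite !ler_norml => /andP[? ?] /andP[? ?].
by split; apply/andP; split => /=; lra.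
Qed.

(** The constants are fixed in the order [c3], [c4], [c2], [ep], [ka], before any profile is given,
    so [K] is uniform. A square of side 4 contains the set and is cut into patches of side [ep]. *)
Lemma planar_area (L m0 l1 kap cs room : R) :
  1 <= L -> 0 < m0 -> 0 < l1 -> 0 < cs -> 2 * cs <= kap -> 0 < room ->
  exists2 K : R, 0 < K &
  forall (t0 t1 sg Dl : R) (u u1 u2 w w1 w2 : R -> R),
    profile_pair t0 t1 L m0 l1 kap cs sg Dl u u1 u2 w w1 w2 ->
  forall (v : R * R) (j0 j1 ta e : R), 0 < e -> j1 < t1 -> t0 + room <= j0 ->
    (sg = -1 -> covered (sublevel u w v j0 j1 ta e) (K * (e / Dl))) /\
    (sg = 1 -> forall n, covered (sublevel u w v j0 j1 ta e)
      (K * (n.+1%:R * (e / Dl) + (2 ^+ n)^-1 ^+ 2))).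
Proof.
have ar1 (K1 K2 K3 : R) n : 0 <= K1 -> 0 <= K2 -> 0 <= K3 ->
    K1 + n%:R * K3 <= (K1 + K2 + K3 + 1) * n.+1%:R.
  move=> k1 k2 k3; rewrite -[n.+1%:R]natr1; have n0 : 0 <= n%:R :> R by exact: ler0n.
  have := mulr_ge0 n0 k1; have := mulr_ge0 n0 k2; lra.
have ar2 (K1 K2 K3 : R) : 0 <= K1 -> 0 <= K2 -> 0 <= K3 ->
  [/\ 0 <= K1 + K2, K1 + K2 <= K1 + K2 + K3 + 1, 1 <= K1 + K2 + K3 + 1
    & 0 < K1 + K2 + K3 + 1] by move=> *; split; lra.
have ar3 (x : R) : 0 < x -> 8 * x <= 1 -> x ^+ 2 <= 1.
  by move=> *; rewrite expr_le1//; lra.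
move=> L1 m00 l10 cs0 kc room0.
have L0 : 0 < L by lra.
have kap0 : 0 < kap by lra.
pose c3 := l1 / (2 * (L + l1)).
have Ll0 : 0 < 2 * (L + l1) by lra.
have c30 : 0 < c3 by rewrite divr_gt0.
have c3E : 2 * c3 * (L + l1) <= l1.
  have -> : 2 * c3 * (L + l1) = l1; last by [].
  by rewrite /c3; field; rewrite gt_eqF//; lra.
have [c4 c40 [c4a c4b _ _]] :
    exists2 x : R, 0 < x & [/\ x <= kap * c3 / 2, x <= m0 * c3 / 8, x <= 1 & x <= 1].
  by apply: ex_le4 => //; rewrite divr_gt0// mulr_gt0.
have [c2 c20 [c2a c2b c2c c2d]] : exists2 x : R, 0 < x & [/\ x <= l1 * m0 / (2 * (m0 + 2 * l1)),
    x <= c3 * cs, x <= m0 * c3 / 8 & x <= m0 * c4 / (32 * L)].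
  have ml : 0 < 2 * (m0 + 2 * l1) by lra.
  have L32 : 0 < 32 * L by lra.
  by apply: ex_le4; [apply: divr_gt0 => //; exact: mulr_gt0 | exact: mulr_gt0
    | rewrite divr_gt0// mulr_gt0 | apply: divr_gt0 => //; exact: mulr_gt0].
have {}c4a : 2 * c4 <= kap * c3 by lra.
have {}c4b : 8 * c4 <= m0 * c3 by lra.
have {}c2c : 8 * c2 <= m0 * c3 by lra.
have {}c2a : 2 * c2 * (m0 + 2 * l1) <= l1 * m0.
  have ml : 0 < 2 * (m0 + 2 * l1) by lra.
  by move: c2a; rewrite (ler_pdivlMr _ _ ml); lra.
have {}c2d : 32 * L * c2 <= m0 * c4.
  by move: c2d; rewrite ler_pdivlMr ?mulr_gt0//; lra.
have L832 : 0 < 832 * L by lra.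
have L96 : 0 < 96 * L by lra.
have [em em0 [ema emb emc emd]] : exists2 x : R, 0 < x &
    [/\ x <= room / 4, x <= c2 / (832 * L), x <= c4 / (96 * L) & x <= 1 / 8].
  by apply: ex_le4; [lra | exact: divr_gt0 | exact: divr_gt0 | lra].
have [kg hkg] := ex_natr_ge (4 / em).
have kg0 : 0 < kg.+1%:R :> R by rewrite ltr0n.
(* A quotient of 4 by an integer, so that the grid fits exactly. *)
pose ep : R := 4 / kg.+1%:R.
have ep0 : 0 < ep by rewrite divr_gt0.
have epm : ep <= em by rewrite ler_pdivrMr// mulrC -ler_pdivrMr.
have epa : 832 * L * ep <= c2.
  by move: (le_trans epm emb); rewrite (ler_pdivlMr _ _ L832); lra.
have epb : 96 * L * ep <= c4.
  by move: (le_trans epm emc); rewrite (ler_pdivlMr _ _ L96); lra.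
have epc : 8 * ep <= 1 by lra.
have epe : 2 * ep < room by lra.
clear ema emb emc emd hkg L832 L96 epm em0.
have [ka hka] := ex_natr_ge (512 * (13 * L) / (c4 / 2)).
have c42 : 0 < c4 / 2 by lra.
have ka1 : 512 * (13 * L) <= c4 / 2 * ka.+1%:R.
  by move: hka; rewrite (ler_pdivrMr _ _ c42); lra.
have ka2 : 256 * (13 * L) <= c4 / 2 * ka.+1%:R by lra.
clear hka.
pose K1 := 64 * ep / c2.
pose K2 := 512 * ka.+1%:R / (c4 / 2).
pose K3 := ka.+1%:R ^+ 2 / (13 * L).
have K10 : 0 <= K1.
  by apply: divr_ge0 (ltW c20); apply: mulr_ge0 (ltW ep0); exact: ler0n.
have K20 : 0 <= K2.
  by apply: divr_ge0; [apply: mulr_ge0; exact: ler0n | exact: ltW].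
have K30 : 0 <= K3.
  by apply: divr_ge0; [exact: sqr_ge0 | apply: mulr_ge0 (ltW L0); exact: ler0n].
have [K12 K123 K123' K1230] := ar2 _ _ _ K10 K20 K30.
exists (kg.+1%:R ^+ 2 * (K1 + K2 + K3 + 1)).
  by rewrite mulr_gt0 ?exprn_gt0//; case: (ar2 K1 K2 K3).
move=> t0 t1 sg Dl u u1 u2 w w1 w2 pp v j0 j1 ta e e0 j1t j0t.
have Dl0 := pp_Dl pp; have t12 := pp_t1 pp.
set S := sublevel _ _ _ _ _ _ _.
have M0 : 0 < Dl + enorm2 v by apply: ltr_pwDl => //; exact: enorm2_ge0.
(* The patches give e / M; dropping |v| makes the bound uniform in the translation. *)
have eM : e / (Dl + enorm2 v) <= e / Dl.
  by rewrite ler_pM2l// lef_pV2 ?posrE// lerDl enorm2_ge0.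
have eD : 0 <= e / Dl by rewrite divr_ge0// ltW.
have eM0 : 0 <= e / (Dl + enorm2 v) by rewrite divr_ge0// ltW.
have Sbox : S `<=` box ((-2, -2), (4, 4)).
  by apply: sublevel_sub_box; apply: le_trans (ltW j1t) t12.
have grid m : (forall q, covered (S `&` box (q, (ep, ep))) m) ->
    covered S (kg.+1%:R ^+ 2 * m).
  by move=> h; apply: (@covered_grid _ _ _ 4 kg (-2, -2)).
have seg q X Y : (S `&` box (q, (ep, ep))) X -> (S `&` box (q, (ep, ep))) Y ->
    segdom t0 t1 v X Y.
  move=> [[/andP[a1 a2] /andP[a3 a4] _] Xq] [[/andP[b1 b2] /andP[b3 b4] _] Yq].
  apply: (@segdom_annulus _ _ _ _ X Y j0 j1 (2 * ep)) => //.
    by apply: lt_le_trans j0t; rewrite ltrD2l; exact: epe.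
  exact: box_diam Yq Xq.
have low q X : (S `&` box (q, (ep, ep))) X -> `|gap u w v X - ta| <= e.
  by move=> [[]].
have Sq q : S `&` box (q, (ep, ep)) `<=` box (q, (ep, ep)) by move=> X [].
split=> sgE.
  rewrite -mulrA; apply: grid => q.
  apply: (covered_sub _ _ (elliptic_patch pp c20 c30 c40 c2a c3E c2b c2c c4a c4b c2d
    ep0 epa epc e0 (Sq q) (seg q) (low q) sgE ka1)) => //.
  by rewrite -/K1 -/K2; apply: ler_pM.
move=> n; rewrite -mulrA; apply: grid => q.
apply: (covered_sub _ _ (hyperbolic_patch pp c20 c30 c40 c2a c3E c2b c2c c4a c4b c2d
    ep0 epa epb e0 (Sq q) (seg q) (low q) n sgE ka2)) => //.
rewrite -/K1 -/K3 mulrDr; apply: lerD.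
  apply: (@le_trans _ _ ((K1 + n%:R * K3) * (e / Dl))).
    apply: ler_wpM2l => //; rewrite addr_ge0// mulr_ge0//.
  rewrite [leRHS]mulrA; apply: ler_wpM2r => //.
  exact: ar1.
rewrite exprMn; apply: ler_wpM2r; first exact: sqr_ge0.
by apply: le_trans K123'; exact: ar3.
Qed.

End PlanarArea.

(** * Derivatives relative to a closed interval *)

Section RelativeDerivative.
Context {R : realType}.

Lemma within_continuous_dist (a b : R) (h : R -> R) :
  (forall t : R, a <= t <= b -> forall e : R, 0 < e -> exists2 r : R, 0 < r &
     forall y : R, a <= y <= b -> `|y - t| < r -> `|h y - h t| < e) ->
  {within `[a, b], continuous h}.
Proof.
move=> H; apply/subspace_continuousP => t; rewrite /= in_itv /= => tab.
apply/cvgrPdist_lt => e e0; have [r r0 hr] := H t tab e e0.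
rewrite /prop_near1 /= /within /= -nbhs_ballE; exists r => // y.
rewrite -ball_normE /= in_itv /= distrC => yr yab; rewrite distrC; exact: hr.
Qed.

Lemma derive_in_approx (D : set R) (h : R -> R) (t e : R) :
  derivable_in D h t -> 0 < e ->
  exists2 r : R, 0 < r & forall y, y != t -> D y -> `|y - t| < r ->
    `|derive_in D h t - (h y - h t) / (y - t)| < e.
Proof.
move=> dh e0.
have /cvgrPdist_lt/(_ e e0) : diff_quot h t y @[y --> within D t^'] --> derive_in D h t.
  exact: dh.
rewrite /prop_near1 /= /within /= /dnbhs /within /= -nbhs_ballE => -[r r0 hr].
exists r => // y yt Dy yr; apply: hr => //.
by rewrite -ball_normE /= distrC.
Qed.

Lemma is_derive_in (t0 t1 t : R) (h : R -> R) : t0 < t < t1 ->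
  derivable_in `[t0, t1]%classic h t ->
  is_derive t 1 h (derive_in `[t0, t1]%classic h t).
Proof.
move=> /andP[tt0 tt1] dh; set l := derive_in _ _ _.
have H : (fun x => x^-1 *: ((h \o shift t) (x *: (1 : R)) - h t)) @ (0 : R)^' --> l.
  apply/cvgrPdist_lt => e e0.
  have [r r0 hr] := derive_in_approx dh e0.
  rewrite /prop_near1 /= /dnbhs /within /= -nbhs_ballE.
  exists (Num.min r (Num.min (t - t0) (t1 - t))).
    by rewrite /= !lt_min r0 !subr_gt0 tt0.
  move=> x; rewrite -ball_normE /= sub0r normrN !lt_min => /and3P[xr x1 x2] xn.
  have := hr (x + t); rewrite -/l addrK => /(_ _ _ xr) hx.
  rewrite /GRing.scale /= mulr1 mulrC; apply: hx.
    by rewrite -subr_eq0 addrK.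
  rewrite /= in_itv /=; move: x1 x2; rewrite !ltr_norml => /andP[? ?] /andP[? ?].
  by apply/andP; split; lra.
apply: DeriveDef; first by apply/cvg_ex; exists l.
exact: cvg_lim H.
Qed.

(** Supplies the bound on g_tt itself: [reg_norm] contains only its Lipschitz norm, but g_t is
    Lipschitz in t. *)
Lemma derive_in_le (t0 t1 t L : R) (h : R -> R) : t0 < t < t1 ->
  derivable_in `[t0, t1]%classic h t ->
  (forall s, t0 <= s <= t1 -> `|h s - h t| <= L * `|s - t|) ->
  `|derive_in `[t0, t1]%classic h t| <= L.
Proof.
move=> /andP[tt0 tt1] dh hL; apply/ler_addgt0Pl => e e0.
have [r r0 hr] := derive_in_approx dh e0.
pose d := Num.min (r / 2) ((t1 - t) / 2).
have d0 : 0 < d by rewrite lt_min !divr_gt0// subr_gt0.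
have dr : d <= r / 2 by rewrite ge_min lexx.
have dt : d <= (t1 - t) / 2 by rewrite ge_min lexx orbT.
have ds : t0 <= t + d <= t1 by apply/andP; split; lra.
have := hr (t + d); rewrite addrAC subrr add0r gtr0_norm//.
have -> : t + d != t by rewrite -subr_eq0 addrAC subrr add0r gt_eqF.
have h1 : `|(h (t + d) - h t) / d| <= L.
  rewrite normrM normfV (gtr0_norm d0) ler_pdivrMr//.
  by apply: (le_trans (hL _ ds)); rewrite addrAC subrr add0r gtr0_norm.
move=> /(_ isT); rewrite /= in_itv /= => /(_ ds) h2.
have /h2 h3 : d < r by lra.
set q := (h (t + d) - h t) / d in h1 h3.
have := ler_normD (derive_in `[t0, t1]%classic h t - q) q; rewrite subrK; lra.
Qed.

(* A one-sided difference quotient at the endpoints still gives continuity,    *)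
(* so the mean value theorem applies on the closed interval.                   *)
Lemma lipschitz_in (t0 t1 L : R) (h : R -> R) :
  (forall t, t0 <= t <= t1 -> derivable_in `[t0, t1]%classic h t) ->
  (forall t, t0 <= t <= t1 -> `|derive_in `[t0, t1]%classic h t| <= L) ->
  forall s t, t0 <= s <= t1 -> t0 <= t <= t1 -> `|h s - h t| <= L * `|s - t|.
Proof.
move=> dh hL.
suff H s t : t0 <= s -> s < t -> t <= t1 -> `|h t - h s| <= L * (t - s).
  move=> s t /andP[? ?] /andP[? ?].
  have [st|ts|<-] := ltgtP s t; last by rewrite !subrr normr0 mulr0.
    by rewrite distrC (distrC s) (gtr0_norm (_ : 0 < t - s)) ?subr_gt0//; exact: H.
  by rewrite (gtr0_norm (_ : 0 < s - t)) ?subr_gt0//; exact: H.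
move=> s0 st t1'.
have [||c] := @MVT R h (derive_in `[t0, t1]%classic h) s t st.
- move=> x; rewrite in_itv /= => /andP[sx xt]; apply: is_derive_in.
    by rewrite (le_lt_trans s0 sx) (lt_le_trans xt t1').
  by apply: dh; apply/andP; split; lra.
- apply: within_continuous_dist => x x01 e e0.
  have xI : t0 <= x <= t1 by case/andP: x01 => ? ?; apply/andP; split; lra.
  have [r r0 hr] := derive_in_approx (dh x xI) ltr01.
  set l := derive_in _ _ _ in hr.
  have l1 : 0 < `|l| + 1 by have := normr_ge0 l; lra.
  exists (Num.min r (e / (`|l| + 1))); first by rewrite lt_min r0 divr_gt0.
  move=> y y01; rewrite lt_min => /andP[yr ye].
  have [->|yx] := eqVneq y x; first by rewrite subrr normr0.
  have yI : `[t0, t1]%classic y.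
    by rewrite /= in_itv /=; case/andP: y01 => ? ?; apply/andP; split; lra.
  have yx0 : y - x != 0 by rewrite subr_eq0.
  have hy := hr y yx yI yr; set q := (h y - h x) / (y - x) in hy.
  have -> : h y - h x = q * (y - x) by rewrite /q divfK.
  have qle : `|q| <= `|l| + 1.
    by have := ler_normB l (l - q); rewrite opprB addrC subrK; lra.
  rewrite normrM; apply: le_lt_trans (ler_wpM2r (normr_ge0 _) qle) _.
  by rewrite mulrC -ltr_pdivlMr.
- rewrite in_itv /= => /andP[sc ct] ->; rewrite normrM.
  have ts : 0 < t - s by rewrite subr_gt0.
  rewrite (gtr0_norm ts); apply: ler_wpM2r; first exact: ltW.
  by apply: hL; apply/andP; split; lra.
Qed.

End RelativeDerivative.

(** * What the norms, the infima and the determinant condition give pointwise *)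

Section Bounds.
Context {R : realType}.
Implicit Types (A I : set R) (f g : R -> R -> R).

Lemma Lip_normP A I f (L : R) : 0 <= L -> (Lip_norm A I f <= L%:E)%E ->
  forall a t b s, A a -> I t -> A b -> I s ->
    `|f a t - f b s| <= L * (`|a - b| + `|t - s|).
Proof.
move=> L0 hL a t b s Aa It Ab Is.
have [[-> ->]|ne] := pselect ((a, t) = (b, s)).
  by rewrite !subrr normr0 addr0 mulr0.
have d0 : 0 < `|a - b| + `|t - s|.
  rewrite lt_neqAle eq_sym addr_ge0// andbT; apply/negP => /eqP h; apply: ne.
  have := normr_ge0 (a - b); have := normr_ge0 (t - s) => h1 h2.
  have /eqP : `|a - b| = 0 by lra.
  have /eqP : `|t - s| = 0 by lra.
  by rewrite !normr_eq0 !subr_eq0 => /eqP -> /eqP ->.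
rewrite -ler_pdivrMr// -lee_fin; apply: le_trans hL.
by apply: ereal_sup_ubound; exists ((a, t), (b, s)).
Qed.

Lemma sup_normP A I f (L : R) : (sup_norm A I f <= L%:E)%E ->
  forall a t, A a -> I t -> `|f a t| <= L.
Proof.
move=> hL a t Aa It; rewrite -lee_fin; apply: le_trans hL.
by apply: ereal_sup_ubound; exists (a, t).
Qed.

(** Two distinct points make all three suprema nonnegative, so each is at most the sum; a supremum
    over no pairs would be [-oo]. *)
Lemma reg_normP A I g (L : R) a t b s :
  A a -> I t -> A b -> I s -> (a, t) <> (b, s) ->
  (reg_norm A I g <= L%:E)%E ->
  [/\ (sup_norm A I (dt I g) <= L%:E)%E, (Lip_norm A I (dt I g) <= L%:E)%E
    & (Lip_norm A I (dt I (dt I g)) <= L%:E)%E].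
Proof.
move=> Aa It Ab Is ne; rewrite /reg_norm => h.
have s0 : (0 <= sup_norm A I (dt I g))%E.
  apply: (@le_trans _ _ `|dt I g a t|%:E); first by rewrite lee_fin.
  by apply: ereal_sup_ubound; exists (a, t).
have l0 f : (0 <= Lip_norm A I f)%E.
  apply: (@le_trans _ _ (`|f a t - f b s| / dist1 (a, t) (b, s))%:E).
    by rewrite lee_fin divr_ge0// addr_ge0.
  by apply: ereal_sup_ubound; exists ((a, t), (b, s)).
have hl := l0 (dt I g); have hl2 := l0 (dt I (dt I g)).
split; apply: le_trans h.
- by rewrite -addeA leeDl// adde_ge0.
- by rewrite addeAC leeDr// adde_ge0.
- by rewrite leeDr// adde_ge0.
Qed.

Lemma lambda1P A I g (l1 : R) : (l1%:E <= lambda1 A I g)%E ->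
  forall a b t, A a -> A b -> I t -> l1 * `|a - b| <= `|dt I g a t - dt I g b t|.
Proof.
move=> h a b t Aa Ab It.
have [->|ne] := eqVneq a b; first by rewrite !subrr normr0 mulr0.
rewrite -ler_pdivlMr ?normr_gt0 ?subr_eq0// -lee_fin; apply: (le_trans h).
have h1 : (lambda1 A I g <= ereal_inf [set (`|dt I g p.1 t - dt I g p.2 t| / `|p.1 - p.2|)%:E
              | p in [set p : R * R | [/\ A p.1, A p.2 & p.1 <> p.2]]])%E.
  by apply: ereal_inf_lbound; exists t.
apply: (le_trans h1); apply: ereal_inf_lbound; exists (a, b) => //=.
by split => //; apply/eqP.
Qed.

Lemma kappaP A I g (k : R) : (k%:E <= kappa A I g)%E ->
  forall a t b s, A a -> I t -> A b -> I s -> a <> b ->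
  k * (`|a - b| + `|t - s|) <=
    `|dt I g a t - dt I g b s| + `|dt I (dt I g) a t - dt I (dt I g) b s|.
Proof.
move=> h a t b s Aa It Ab Is ne.
have d0 : 0 < `|a - b| + `|t - s|.
  by apply: ltr_pwDl => //; rewrite normr_gt0 subr_eq0; apply/eqP.
rewrite -ler_pdivlMr// -lee_fin; apply: (le_trans h).
apply: ereal_inf_lbound; exists ((a, t), (b, s)) => //; split => //=.
by case=> /ne.
Qed.

Lemma inf_absP A I f (m : R) : (m%:E <= inf_abs A I f)%E ->
  forall a t, A a -> I t -> m <= `|f a t|.
Proof.
move=> h a t Aa It; rewrite -lee_fin; apply: (le_trans h).
by apply: ereal_inf_lbound; exists (a, t).
Qed.

(** A Lipschitz function is continuous, so |f| attains its minimum on the compact rectangle. *)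
Lemma inf_abs_gt0 (a0 a1 t0 t1 L : R) f : a0 <= a1 -> t0 <= t1 ->
  let A : set R := `[a0, a1]%classic in let I : set R := `[t0, t1]%classic in
  (forall a t b s, A a -> I t -> A b -> I s ->
    `|f a t - f b s| <= L * (`|a - b| + `|t - s|)) ->
  (forall a t, A a -> I t -> f a t <> 0) ->
  (0 < inf_abs A I f)%E.
Proof.
move=> a01 t01 A I fL fn.
have AI0 : A `*` I !=set0.
  by exists (a0, t0); split; rewrite /A /I /= in_itv /= lexx.
have AIc : compact (A `*` I) by apply: compact_setX; exact: segment_compact.
have [|[a t]] := @compact_EVT_min _ R (fun p : R * R => `|f p.1 p.2|) _ AI0 AIc.
  apply/subspace_continuousP => -[a t] [/= Aa It]; apply/cvgrPdist_lt => e e0.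
  pose L' := `|L| + 1; have L'0 : 0 < L' by rewrite /L'; have := normr_ge0 L; lra.
  rewrite /prop_near1 /= /within /= -nbhs_ballE; exists (e / (2 * L')).
    by rewrite /= divr_gt0// mulr_gt0.
  move=> [b s] [/= ab ts] [/= Ab Is].
  move: ab ts; rewrite -!ball_normE /= => ab ts.
  apply: le_lt_trans (ler_dist_dist _ _) _.
  apply: le_lt_trans (fL _ _ _ _ Aa It Ab Is) _.
  have n1 := normr_ge0 (a - b); have n2 := normr_ge0 (t - s).
  apply: (@le_lt_trans _ _ (L' * (`|a - b| + `|t - s|))).
    by apply: ler_wpM2r; [lra | rewrite /L'; have := ler_norm L; lra].
  rewrite mulrC -ltr_pdivlMr//; have -> : e / L' = e / (2 * L') + e / (2 * L').
    by field; rewrite gt_eqF.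
  exact: ltrD.
rewrite inE => -[/= Aa It] hmin.
apply: (@lt_le_trans _ _ `|f a t|%:E); first by rewrite lte_fin normr_gt0; apply/eqP; exact: fn.
apply: le_ereal_inf_tmp => _ [[b s] [/= Ab Is] <-].
by rewrite lee_fin; apply: (hmin (b, s)); rewrite inE.
Qed.

Lemma no_sign_change (x0 x1 L : R) (h : R -> R) :
  (forall x y, x0 <= x <= x1 -> x0 <= y <= x1 -> `|h x - h y| <= L * `|x - y|) ->
  (forall x, x0 <= x <= x1 -> h x <> 0) ->
  forall x y, x0 <= x <= x1 -> x0 <= y <= x1 -> 0 < h x * h y.
Proof.
move=> hL hn.
suff H x y : x0 <= x <= x1 -> x0 <= y <= x1 -> x <= y -> 0 < h x * h y.
  move=> x y hx hy; have [xy|/ltW yx] := leP x y; first exact: H.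
  by rewrite mulrC; exact: H.
move=> hx hy xy; rewrite ltNge; apply/negP => hxy.
have cont : {within `[x, y], continuous h}.
  apply: within_continuous_dist => t txy e e0.
  have inI z : x <= z <= y -> x0 <= z <= x1.
    by case/andP: hx => ? ?; case/andP: hy => ? ? /andP[? ?]; apply/andP; split; lra.
  have L1 : 0 < `|L| + 1 by have := normr_ge0 L; lra.
  exists (e / (`|L| + 1)); first by rewrite divr_gt0.
  move=> z zxy; rewrite ltr_pdivlMr// mulrC => zt.
  apply: le_lt_trans (hL z t (inI _ zxy) (inI _ txy)) _; apply: le_lt_trans zt.
  by apply: ler_wpM2r => //; have := ler_norm L; lra.
have [|c cxy hc] := @IVT R h x y 0 xy cont.
  rewrite ge_min le_max; case: (lerP 0 (h x)) => h0.
    case: (lerP (h y) 0) => h1; first by rewrite !orbT.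
    have hx0 : h x != 0 by apply/eqP; exact: hn.
    have : 0 < h x * h y by rewrite mulr_gt0// lt_neqAle eq_sym hx0.
    by rewrite ltNge hxy.
  case: (lerP 0 (h y)) => h1; first by rewrite !orbT (ltW h0).
  by have := nmulr_rgt0 (h y) h0; rewrite h1 ltNge hxy.
apply: hn hc; move: cxy; rewrite in_itv /= => /andP[? ?].
by case/andP: hx => ? ?; case/andP: hy => ? ?; apply/andP; split; lra.
Qed.

(** Each point is joined to (a0, t0) first in t and then in a, with the intermediate value theorem
    on each leg. *)
Lemma constant_sign (a0 a1 t0 t1 L : R) f : a0 <= a1 -> t0 <= t1 ->
  let A : set R := `[a0, a1]%classic in let I : set R := `[t0, t1]%classic in
  (forall a t b s, A a -> I t -> A b -> I s ->
    `|f a t - f b s| <= L * (`|a - b| + `|t - s|)) ->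
  (forall a t, A a -> I t -> f a t <> 0) ->
  exists2 o : R, o = 1 \/ o = -1 &
    forall a t, A a -> I t -> o * f a t = `|f a t|.
Proof.
move=> a01 t01 A I fL fn.
have inA a : (a0 <= a <= a1) = (a \in A) by rewrite /A mem_setE in_itv.
have inI t : (t0 <= t <= t1) = (t \in I) by rewrite /I mem_setE in_itv.
have Aa0 : A a0 by rewrite /A /= in_itv /= lexx.
have It0 : I t0 by rewrite /I /= in_itv /= lexx.
have st a t : A a -> I t -> 0 < f a t * f a t0.
  move=> Aa It; apply: (@no_sign_change t0 t1 L (f a)); rewrite ?inI ?inE//.
    move=> x y; rewrite !inI !inE => Ix Iy.
    by have := fL a x a y Aa Ix Aa Iy; rewrite subrr normr0 add0r.
  by move=> x; rewrite inI inE => Ix; exact: fn.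
have sa a : A a -> 0 < f a t0 * f a0 t0.
  move=> Aa; apply: (@no_sign_change a0 a1 L (fun a => f a t0)); rewrite ?inA ?inE//.
    move=> x y; rewrite !inA !inE => Ax Ay.
    by have := fL x t0 y t0 Ax It0 Ay It0; rewrite subrr normr0 addr0.
  by move=> x; rewrite inA inE => Ax; exact: fn.
have [f0|f0] := ltP 0 (f a0 t0).
  exists 1; first by left.
  move=> a t Aa It; rewrite mul1r gtr0_norm//.
  by have := st a t Aa It; have := sa a Aa; rewrite (pmulr_lgt0 _ f0) => h; rewrite (pmulr_lgt0 _ h).
have {}f0 : f a0 t0 < 0 by rewrite lt_neqAle f0 andbT; apply/eqP; exact: fn.
exists (-1); first by right.
move=> a t Aa It; rewrite mulN1r ltr0_norm//.
by have := st a t Aa It; have := sa a Aa; rewrite (nmulr_lgt0 _ f0) => h; rewrite (nmulr_lgt0 _ h).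
Qed.

Lemma cinematic_detE I g (a a' t t' : R) : cinematic_det I g a a' t t' =
  (dt I g a' t' - dt I g a' t) * (dt I (dt I g) a' t - dt I (dt I g) a t)
  - (dt I g a' t - dt I g a t) * (dt I (dt I g) a' t' - dt I (dt I g) a' t).
Proof.
by rewrite /cinematic_det (expand_det_row _ ord0) !big_ord_recl big_ord0 /cofactor
  !det_mx11 !mxE /=; ring.
Qed.

(* With e := p + q one has (pQ - qP) q = e q Q - q^2 (P + Q), and the smallness *)
(* of e makes the last term dominate.                                          *)
Lemma det_sign (p q P Q c sg cs L l1 kap Dl E : R) :
  sg = 1 \/ sg = -1 -> 0 < c -> 0 < l1 -> 0 < kap -> 0 < Dl -> Dl <= E ->
  2 * cs <= kap -> 4 * L * cs <= l1 * kap ->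
  `|p + q| <= cs * E -> `|Q| <= L * Dl -> l1 * Dl <= `|q| ->
  kap * E <= `|p + q| + `|P + Q| ->
  0 < - sg * ((p * Q - q * P) * q * c) -> 0 < sg * (P + Q).
Proof.
move=> sg1 c0 l10 k0 D0 DE cs2 csL he hQ hq hk hd.
have E0 : 0 < E by lra.
have {}hd : 0 < - sg * ((p * Q - q * P) * q) by move: hd; rewrite mulrA (pmulr_lgt0 _ c0).
rewrite ltNge; apply/negP => hn.
have sPQ : sg * (P + Q) = - `|P + Q|.
  have : `|sg * (P + Q)| = `|P + Q|.
    by rewrite normrM; case: sg1 => ->; rewrite ?normrN normr1 mul1r.
  by rewrite (ler0_norm hn) => <-; rewrite opprK.
have h1 : - sg * ((p * Q - q * P) * q) = - (`|q| ^+ 2 * `|P + Q|) - sg * ((p + q) * q * Q).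
  have -> : `|P + Q| = - (sg * (P + Q)) by rewrite sPQ opprK.
  rewrite real_normK ?num_real//; ring.
have h2 : - (sg * ((p + q) * q * Q)) <= `|q| * (cs * E * (L * Dl)).
  apply: (le_trans (ler_norm _)); rewrite normrN !normrM.
  have -> : `|sg| = 1 by case: sg1 => ->; rewrite ?normrN normr1.
  have -> : 1 * (`|p + q| * `|q| * `|Q|) = `|q| * (`|p + q| * `|Q|) by ring.
  by apply: ler_wpM2l => //; exact: ler_pM.
have q0 : 0 < `|q| by apply: lt_le_trans hq; rewrite mulr_gt0.
have h3 : kap / 2 * E <= `|P + Q|.
  have : 2 * cs * E <= kap * E by apply: ler_wpM2r => //; exact: ltW.
  lra.
have h4 : l1 * Dl * (kap / 2 * E) <= `|q| * `|P + Q|.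
  apply: ler_pM => //; apply: mulr_ge0; try exact: ltW; rewrite ?divr_ge0// ltW//.
have h5 : cs * E * (L * Dl) <= l1 * kap / 4 * (Dl * E).
  have := ler_wpM2r (ltW (mulr_gt0 D0 E0)) csL; lra.
have h6 : 0 < l1 * kap * (Dl * E) by rewrite !mulr_gt0.
have h7 : cs * E * (L * Dl) < `|q| * `|P + Q| by lra.
have h8 : `|q| * (cs * E * (L * Dl)) < `|q| * (`|q| * `|P + Q|) by rewrite ltr_pM2l.
rewrite h1 in hd; lra.
Qed.

End Bounds.

(** * From overlaps of thickened surfaces to planar sublevel sets *)

Section Overlap.
Context {R : realType}.
Context {a0 a1 t0 t1 L : R} {g : R -> R -> R}.
Local Notation A := `[a0, a1]%classic.
Local Notation I := `[t0, t1]%classic.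
Local Notation J := `[t1 - (t1 - t0) / 2, t1]%classic.
Local Notation gt := (dt I g).
Local Notation gtt := (dt I gt).
Context (t01 : t0 < t1) (t0ge1 : 1 <= t0) (t1le2 : t1 <= 2) (L1 : 1 <= L).
Context (dg : has_dt A I g) (dgt : has_dt A I gt).
Context (gtL : forall a t, A a -> I t -> `|gt a t| <= L).
Context (gtLip : forall a t b s, A a -> I t -> A b -> I s ->
  `|gt a t - gt b s| <= L * (`|a - b| + `|t - s|)).
Context (gttLip : forall a t b s, A a -> I t -> A b -> I s ->
  `|gtt a t - gtt b s| <= L * (`|a - b| + `|t - s|)).

Let inI (t : R) : t0 <= t <= t1 -> I t.
Proof. by move=> h; rewrite /= in_itv. Qed.

Let inI' (t : R) : t0 < t < t1 -> I t.
Proof. by move=> /andP[? ?]; apply: inI; rewrite !ltW. Qed.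

Lemma profile_of (m0 l1 kap cs sg o a a' : R) :
  0 < m0 -> 0 < l1 -> 0 < cs -> 2 * cs <= kap -> 4 * L * cs <= l1 * kap ->
  sg = 1 \/ sg = -1 -> o = 1 \/ o = -1 ->
  (forall a t, A a -> I t -> m0 <= o * gt a t) ->
  (forall a b t, A a -> A b -> I t -> l1 * `|a - b| <= `|gt a t - gt b t|) ->
  (forall a t b s, A a -> I t -> A b -> I s -> a <> b ->
    kap * (`|a - b| + `|t - s|) <= `|gt a t - gt b s| + `|gtt a t - gtt b s|) ->
  (forall a a' t t', A a -> A a' -> I t -> I t' -> a' <> a -> t < t' ->
    0 < - sg * (cinematic_det I g a a' t t' * (gt a' t - gt a t) * gt a t)) ->
  A a -> A a' -> a' <> a ->
  profile_pair t0 t1 L m0 l1 kap cs sg `|a' - a|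
    (fun t => o * g a' t) (fun t => o * gt a' t) (fun t => o * gtt a' t)
    (fun t => o * g a t) (fun t => o * gt a t) (fun t => o * gtt a t).
Proof.
move=> m00 l10 cs0 kc Lcs sg1 o1 hm hl hk hs Aa Aa' ne.
have oabs x : `|o * x| = `|x|.
  by rewrite normrM; case: o1 => ->; rewrite ?normrN normr1 mul1r.
have oB x y : o * x - o * y = o * (x - y) by rewrite mulrBr.
have oo : o * o = 1 by case: o1 => ->; ring.
have d0 : 0 < `|a' - a| by rewrite normr_gt0 subr_eq0; apply/eqP.
have db b (t : R) : A b -> t0 < t < t1 -> is_derive t 1 (fun t => o * g b t) (o * gt b t).
  move=> Ab ht; have d : is_derive t 1 (g b) (gt b t).
    by apply: is_derive_in => //; apply: dg => //; exact: inI'.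
  by apply: is_derive_eq; rewrite /GRing.scale.
have dbt b (t : R) : A b -> t0 < t < t1 -> is_derive t 1 (fun t => o * gt b t) (o * gtt b t).
  move=> Ab ht; have d : is_derive t 1 (gt b) (gtt b t).
    by apply: is_derive_in => //; apply: dgt => //; exact: inI'.
  by apply: is_derive_eq; rewrite /GRing.scale.
have bd b (t : R) : A b -> t0 < t < t1 -> m0 <= o * gt b t <= L.
  move=> Ab ht; rewrite hm//=; last exact: inI'.
  by apply: (le_trans (ler_norm _)); rewrite oabs; apply: gtL => //; exact: inI'.
(* In [det_sign], p and P are increments in time at b', q and Q increments in the parameter at time
   x; p + q and P + Q thus compare (b', y) with (b, x). *)
have sign_aux b b' (x y : R) : A b -> A b' -> b' <> b -> t0 < x < t1 -> t0 < y < t1 ->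
    x < y -> `|o * gt b' y - o * gt b x| <= cs * (`|b' - b| + `|y - x|) ->
    0 < sg * (o * gtt b' y - o * gtt b x).
  move=> Ab Ab' nb hx hy xy hsm.
  have Ix := inI' hx; have Iy := inI' hy.
  have nb' : 0 < `|b' - b| by rewrite normr_gt0 subr_eq0; apply/eqP.
  have := @det_sign R (o * (gt b' y - gt b' x)) (o * (gt b' x - gt b x))
    (o * (gtt b' y - gtt b' x)) (o * (gtt b' x - gtt b x)) (o * gt b x) sg cs L l1 kap
    `|b' - b| (`|b' - b| + `|y - x|) sg1.
  have -> : o * (gt b' y - gt b' x) + o * (gt b' x - gt b x) = o * gt b' y - o * gt b x by ring.
  have -> : o * (gtt b' y - gtt b' x) + o * (gtt b' x - gtt b x) =
    o * gtt b' y - o * gtt b x by ring.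
  apply => //.
  - exact: lt_le_trans (hm b x Ab Ix).
  - lra.
  - by rewrite lerDl.
  - by rewrite oabs; have := gttLip Ab' Ix Ab Ix; rewrite subrr normr0 addr0.
  - by rewrite oabs; exact: hl.
  - by rewrite !oB !oabs; exact: hk.
  - have := hs b b' x y Ab Ab' Ix Iy nb xy; rewrite cinematic_detE.
    set p := gt b' y - _; set q := gt b' x - _; set P := gtt b' y - _; set Q := gtt b' x - _.
    suff -> : (o * p * (o * Q) - o * q * (o * P)) * (o * q) * (o * gt b x) =
       (p * Q - q * P) * q * gt b x by [].
    transitivity ((o * o) * (o * o) * ((p * Q - q * P) * q * gt b x)); first by ring.
    by rewrite oo !mul1r.
split => //.
- by move=> t ht; exact: db.
- by move=> t ht; exact: dbt.
- by move=> t ht; exact: db.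
- by move=> t ht; exact: dbt.
- by move=> t ht; exact: bd.
- by move=> t ht; exact: bd.
- move=> t ht; rewrite oabs; apply: derive_in_le => //.
    by apply: dgt => //; exact: inI'.
  move=> s hs'; have := gtLip Aa (inI hs') Aa (inI' ht).
  by rewrite subrr normr0 add0r.
- move=> t s ht hs'; rewrite oB oabs; have := gtLip Aa (inI' ht) Aa (inI' hs').
  by rewrite subrr normr0 add0r.
- by move=> t s ht hs'; rewrite oB oabs; apply: gtLip => //; exact: inI'.
- by move=> t s ht hs'; rewrite oB oabs; apply: gttLip => //; exact: inI'.
- by move=> t ht; rewrite oB oabs; apply: hl => //; exact: inI'.
- by move=> t s ht hs'; rewrite !oB !oabs; apply: hk => //; exact: inI'.
(* The determinant condition compares b at the earlier time with b' at the later one, so the order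
   of t and s decides which of a, a' is b. *)
- move=> t s ht hs' ts hsm.
  have [lts|gts] : t < s \/ s < t.
    by have [?|?|//] := ltgtP t s; [left|right].
    have := @sign_aux a' a t s Aa' Aa (nesym ne) ht hs' lts.
    rewrite distrC (distrC a) (distrC s) => /(_ hsm) h.
    have : 0 < sg * (o * gtt a s - o * gtt a' t) * (s - t) by rewrite mulr_gt0// subr_gt0.
    lra.
  have h := sign_aux a a' s t Aa Aa' ne hs' ht gts hsm.
  by rewrite mulr_gt0// subr_gt0.
Qed.

Lemma thicken_GammaP (K : set R) a d X z : thicken (Gamma g K a) d (X, z) ->
  exists Y, [/\ K (enorm2 Y), enorm2 (X - Y) < d & `|z - g a (enorm2 Y)| < d].
Proof.
move=> [[p e]] [/= [Y KY Yp] ed] pe; exists Y.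
have [<- <-] : (Y + e.1, g a (enorm2 Y) + e.2) = (X, z) by rewrite -pe -Yp.
rewrite ![_ + _ - _]addrC !addKr; split => //; apply: le_lt_trans ed.
  by rewrite /enorm2 /enorm3 ler_sqrt ?addr_ge0 ?sqr_ge0// lerDl sqr_ge0.
by rewrite -sqrtr_sqr /enorm3 ler_sqrt ?addr_ge0 ?sqr_ge0// lerDr addr_ge0 ?sqr_ge0.
Qed.

Lemma overlapP (K : set R) a a' d tau X z :
  (translate (thicken (Gamma g K a) d) tau `&` thicken (Gamma g K a') d) (X, z) ->
  (exists Y, [/\ K (enorm2 Y), enorm2 (X - Y) < d & `|z - g a' (enorm2 Y)| < d]) /\
  (exists Y, [/\ K (enorm2 Y), enorm2 (X - tau.1 - Y) < d
               & `|z - tau.2 - g a (enorm2 Y)| < d]).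
Proof.
move=> [[[x y] hx xE] hX]; split; first exact: thicken_GammaP hX.
have [<- <-] : (x + tau.1, y + tau.2) = (X, z) by rewrite -xE.
rewrite !addrK; exact: thicken_GammaP hx.
Qed.

Let JI (t : R) : J t -> t0 <= t <= t1 /\ t1 - (t1 - t0) / 2 <= t <= t1.
Proof.
rewrite /= in_itv /= => /andP[? ?]; split; last by apply/andP.
by apply/andP; split => //; have := t01; lra.
Qed.

Let gLip a (s t : R) : A a -> t0 <= s <= t1 -> t0 <= t <= t1 ->
  `|g a s - g a t| <= L * `|s - t|.
Proof.
move=> Aa; apply: lipschitz_in => [r hr|r hr].
  by apply: dg => //; exact: inI.
by apply: gtL => //; exact: inI.
Qed.

(** The heights are within d of values of g at radii less than 2 d apart, so they differ by at most
    2 d + 2 L d. *)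
Let slice a a' d tau X z z' : A a' ->
  (translate (thicken (Gamma g J a) d) tau `&` thicken (Gamma g J a') d) (X, z) ->
  (translate (thicken (Gamma g J a) d) tau `&` thicken (Gamma g J a') d) (X, z') ->
  `|z' - z| <= 4 * L * d.
Proof.
move=> Aa' /overlapP[[Y [/JI[JY _] XY zY]] _] /overlapP[[Y' [/JI[JY' _] XY' zY']] _].
have h := gLip Aa' JY' JY.
have h2 := enorm2_dist Y' Y.
have h3 := enorm2D (Y' - X) (X - Y); rewrite addrA subrK (enorm2B Y') in h3.
have L1' := L1.
have h4 : L * `|enorm2 Y' - enorm2 Y| <= L * (2 * d).
  by apply: ler_wpM2l; lra.
have dL : d <= L * d by apply: ler_peMl => //; have := enorm2_ge0 (X - Y); lra.
move: h zY zY'; rewrite !ltr_norml !ler_norml => /andP[? ?] /andP[? ?] /andP[? ?].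
by apply/andP; split; lra.
Qed.

Lemma overlap_le (m a a' d : R) (S : R * R * R -> set (R * R)) :
  A a' -> 0 < d ->
  (forall tau, covered (S tau) m) ->
  (forall tau X z, (translate (thicken (Gamma g J a) d) tau
     `&` thicken (Gamma g J a') d) (X, z) -> S tau X) ->
  (sup_overlap g J a a' d <= (8 * L * d * m)%:E)%E.
Proof.
move=> Aa' d0 cS hS; apply: ub_ereal_sup => _ [tau _ <-].
have -> : 8 * L * d * m = 2 * (4 * L * d) * m by ring.
apply: (lebesgue3_le _ (cS tau) (hS tau)) => [|X z z' h h'].
  by rewrite !mulr_ge0 ?(ltW d0)//; have := L1; lra.
exact: slice h h'.
Qed.

(** The shadow lies in the disc of radius 3, hence in a square of side 6. *)
Lemma overlap_trivial (a a' d : R) : A a' -> 0 < d < 1 ->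
  (sup_overlap g J a a' d <= (288 * L * d)%:E)%E.
Proof.
move=> Aa' /andP[d0 d1].
have -> : 288 * L * d = 8 * L * d * (6 * 6) by ring.
apply: (@overlap_le _ _ _ _ (fun=> box ((-3, -3), (6, 6)))) => //.
  by move=> _; apply: (@covered_box _ _ ((-3, -3), (6, 6))).
move=> tau X z /overlapP[[Y [/JI[/andP[_ Y1] _] XY _]] _].
have := enorm2D (X - Y) Y; rewrite subrK => h.
have := le_enorm2_fst X; have := le_enorm2_snd X; have := t1le2.
rewrite !ler_norml => ? /andP[? ?] /andP[? ?].
by split; apply/andP; split => /=; lra.
Qed.

(* Dilating by 1 / (1 + 2 d) moves the d-neighbourhood of the annulus inside   *)
(* |X| < t1, so the profiles need not be extended beyond t1.                   *)
Lemma overlap_sublevel (o m a a' d : R) : A a -> A a' -> o = 1 \/ o = -1 ->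
  0 < d < 1 -> 20 * d <= t1 - t0 -> 0 <= m ->
  (forall v ta, covered (sublevel (fun t => o * g a' t) (fun t => o * g a t) v
     ((t0 + t1) / 2 - 5 * d) ((t1 + d) / (1 + 2 * d)) ta (12 * L * d)) m) ->
  (sup_overlap g J a a' d <= (72 * L * d * m)%:E)%E.
Proof.
move=> Aa Aa' o1 /andP[d0 d1] dt m0 cS.
have d20 : 0 < 1 + 2 * d by lra.
pose l := (1 + 2 * d)^-1.
have l0 : 0 < l by rewrite invr_gt0.
have lE : l * (1 + 2 * d) = 1 by rewrite mulVf// gt_eqF.
(* Undoing the dilation multiplies areas by l^-2 = (1 + 2 d)^2, which is at most 9. *)
have l3 : 1 <= 9 * l ^+ 2.
  have : 1 <= 3 * l by rewrite -lE mulrC; apply: ler_wpM2r; lra.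
  by nra.
have -> : 72 * L * d * m = 8 * L * d * (9 * m) by ring.
apply: (@overlap_le _ _ _ _ (fun tau => [set X | sublevel (fun t => o * g a' t)
  (fun t => o * g a t) (sc l tau.1) ((t0 + t1) / 2 - 5 * d) ((t1 + d) / (1 + 2 * d))
  (o * tau.2) (12 * L * d) (l * X.1, l * X.2)])) => //.
  move=> tau; apply: (covered_sub _ _ (covered_scale l0 (cS (sc l tau.1) (o * tau.2)))) => //.
  by rewrite ler_pdivrMr ?exprn_gt0//; nra.
have t01' := t01; have t1' := t1le2; have t0' := t0ge1; have L1' := L1.
(* The radius of X is within d of that of Y, and the dilation moves it by at most 4 d; hence 5 d.
   Two such errors, times L, and two heights give the level 12 L d. *)
have key X Y : J (enorm2 Y) -> enorm2 (X - Y) < d ->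
    [/\ (t0 + t1) / 2 - 5 * d <= l * enorm2 X <= (t1 + d) / (1 + 2 * d),
        t0 <= l * enorm2 X <= t1 & `|l * enorm2 X - enorm2 Y| <= 5 * d].
  move=> /JI[/andP[Y0 Y1] /andP[Y2 _]] XY.
  have h1 := enorm2D (X - Y) Y; rewrite subrK in h1.
  have h2 := enorm2D (Y - X) X; rewrite subrK (enorm2B Y) in h2.
  set x := enorm2 X in h1 h2 *; set y := enorm2 Y in Y0 Y1 Y2 h1 h2 *.
  have x0 : 0 <= x by exact: enorm2_ge0.
  have u1 : l * x <= (t1 + d) / (1 + 2 * d).
    by rewrite mulrC; apply: ler_wpM2r; [exact: ltW | lra].
  have u2 : (t1 + d) / (1 + 2 * d) <= t1.
    rewrite ler_pdivrMr//; have := ler_wpM2r (ltW d0) (le_trans t0' (ltW t01')); lra.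
  have u3 : x - l * x = 2 * d * (l * x).
    have : l * (1 + 2 * d) * x = x by rewrite lE mul1r.
    lra.
  have lx0 : 0 <= l * x by rewrite mulr_ge0// ltW.
  have u4 : 2 * d * (l * x) <= 4 * d.
    have := ler_wpM2l (ltW d0) (le_trans u1 (le_trans u2 t1')); lra.
  have u5 : 0 <= 2 * d * (l * x) by rewrite mulr_ge0// mulr_ge0// ltW.
  have l1 : (t0 + t1) / 2 - 5 * d <= l * x by lra.
  split; first by rewrite l1.
    by apply/andP; split; lra.
  by rewrite ler_norml; apply/andP; split; lra.
have scE (X : R * R) : (l * X.1, l * X.2) = sc l X by [].
have nsc X : enorm2 (sc l X) = l * enorm2 X by rewrite enorm2_sc gtr0_norm.
move=> tau X z /overlapP[[Y [JY XY zY]] [Y' [JY' XY' zY']]].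
have [k1 k2 k3] := key X Y JY XY; have [k1' k2' k3'] := key _ Y' JY' XY'.
have scB : sc l X - sc l tau.1 = sc l (X - tau.1).
  by apply/eqP; rewrite xpair_eqE /=; apply/andP; split; apply/eqP; ring.
rewrite /= scE; split; rewrite ?scB ?nsc// /gap scB !nsc.
have -> : o * g a' (l * enorm2 X) - o * g a (l * enorm2 (X - tau.1)) - o * tau.2 =
   o * (g a' (l * enorm2 X) - g a (l * enorm2 (X - tau.1)) - tau.2) by ring.
have -> : forall x, `|o * x| = `|x|.
  by move=> x; rewrite normrM; case: o1 => ->; rewrite ?normrN normr1 mul1r.
have g1 := gLip Aa' k2 (proj1 (JI JY)); have g2 := gLip Aa k2' (proj1 (JI JY')).
have L5 (x : R) : x <= 5 * d -> L * x <= 5 * L * d.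
  by move=> h; have := ler_wpM2l (le_trans ler01 L1') h; lra.
have {}g1 := le_trans g1 (L5 _ k3); have {}g2 := le_trans g2 (L5 _ k3').
have dL : d <= L * d by apply: ler_peMl => //; exact: ltW.
move: g1 g2 zY zY'; rewrite !ltr_norml !ler_norml.
move=> /andP[? ?] /andP[? ?] /andP[? ?] /andP[? ?].
by apply/andP; split; lra.
Qed.

End Overlap.

(** * Choice of scale and the bound for one pair of parameters *)

Section MainBound.
Context {R : realType}.

Lemma dyadic_log (d : R) : 0 < d < 1 / 2 ->
  exists n : nat, [/\ (2 ^+ n)^-1 <= d, n.+1%:R <= 3 * (`|ln d| / ln 2)
    & 1 <= `|ln d| / ln 2].
Proof.
move=> /andP[d0 d2].
have l2 : 0 < ln 2 :> R by rewrite ln_gt0// ltr1n.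
have ld : ln d < - ln 2.
  by rewrite -lnV ?posrE// ltr_ln ?posrE// ?invr_gt0//; move: d2; rewrite div1r.
have ld0 : `|ln d| = - ln d by rewrite ltr0_norm//; lra.
set y := `|ln d| / ln 2.
have y1 : 1 <= y by rewrite ler_pdivlMr// mul1r ld0; lra.
have y0 : 0 <= y by lra.
have /andP[t1 t2] := Num.Theory.truncn_itv y0.
(* As y = log_2 (1/d) >= 1, n + 1 <= y + 2 <= 3 y. *)
exists (Num.truncn y).+1; split => //; last by rewrite -!natr1; lra.
have p2 : 0 < 2 ^+ (Num.truncn y).+1 :> R by exact: exprn_gt0.
rewrite -[d]invrK lef_pV2 ?posrE ?invr_gt0//.
rewrite -ler_ln ?posrE ?invr_gt0// lnV ?posrE// lnXn// -[ln 2 *+ _]mulr_natl.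
by move: (ltW t2); rewrite {1}/y ler_pdivrMr// ld0.
Qed.

Lemma quot_ge (d D T : R) : 0 < d -> 0 <= D -> d + D <= T * d ->
  d <= T * (d ^+ 2 / (d + D)).
Proof.
move=> d0 D0 h; have dD : 0 < d + D by lra.
rewrite mulrA ler_pdivlMr//; have := ler_wpM2l (ltW d0) h; lra.
Qed.

Lemma quot_le2 (d D : R) : 0 < d -> d <= D -> d ^+ 2 / D <= 2 * (d ^+ 2 / (d + D)).
Proof.
move=> d0 dD; have D0 : 0 < D by lra.
have dD0 : 0 < d + D by lra.
rewrite mulrA ler_pdivrMr// mulrAC ler_pdivlMr//.
have := ler_wpM2l (sqr_ge0 d) dD; lra.
Qed.

(** In the first alternative d is comparable to d + D and the O(d) bound suffices. Since D <= 2 L /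
    l1, this includes every d above len / 20. *)
Lemma large_or_small (len L l1 d D : R) : 0 < len -> 1 <= L -> 0 < l1 ->
  0 < d -> l1 * D <= 2 * L ->
  d + D <= (3 + 40 * L / (l1 * len)) * d \/ d <= D /\ 20 * d <= len.
Proof.
move=> len0 L1 l10 d0 hD; have ll : 0 < l1 * len by exact: mulr_gt0.
have e0 : 0 <= 40 * L / (l1 * len) by apply: divr_ge0; lra.
have := mulr_ge0 e0 (ltW d0); set e := _ / _ * d => e1.
have -> : (3 + 40 * L / (l1 * len)) * d = 3 * d + e by rewrite mulrDl.
have [dD|Dd] := leP d D; last by left; lra.
have [dl|ld] := leP (20 * d) len; first by right.
left; suff : D <= e by lra.
rewrite /e mulrAC ler_pdivlMr//.
have L0 : 0 <= L by lra.
by have := ler_wpM2r (ltW len0) hD; have := ler_wpM2l L0 (ltW ld); lra.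
Qed.

Lemma elliptic_constant (len L l1 K : R) :
  0 < len -> 1 <= L -> 0 < l1 -> 0 < K ->
  exists C : R, forall (d D : R) (x : \bar R), 0 < d -> 0 <= D ->
    l1 * D <= 2 * L -> (x <= (288 * L * d)%:E)%E ->
    (d <= D -> 20 * d <= len ->
      (x <= (72 * L * d * (K * (12 * L * d / D)))%:E)%E) ->
    (x <= (C * (d ^+ 2 / (d + D)))%:E)%E.
Proof.
move=> len0 L1 l10 K0; have L0 : 0 <= L by lra.
set T := 3 + 40 * L / (l1 * len).
have T0 : 0 <= T.
  by apply: addr_ge0; [lra | apply: divr_ge0; [lra | apply: mulr_ge0; exact: ltW]].
have L288 : 0 <= 288 * L by apply: mulr_ge0 L0; exact: ler0n.
have C10 : 0 <= 288 * L * T by exact: mulr_ge0.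
have C20 : 0 <= 864 * L ^+ 2 * K.
  by apply: mulr_ge0 (ltW K0); apply: mulr_ge0 (sqr_ge0 L); exact: ler0n.
exists (288 * L * T + 864 * L ^+ 2 * K * 2) => d D x d0 D0 hD h1 h2.
have q0 : 0 <= d ^+ 2 / (d + D) by apply: divr_ge0; [exact: sqr_ge0 | lra].
rewrite mulrDl; have [h|[dD dl]] := large_or_small len0 L1 l10 d0 hD.
  apply: (le_trans h1); rewrite lee_fin; apply: ler_wpDr.
    by apply: mulr_ge0 q0; apply: mulr_ge0 C20 _; exact: ler0n.
  by rewrite -[leRHS]mulrA; apply: ler_wpM2l L288 _ _ _; exact: quot_ge.
apply: (le_trans (h2 dD dl)); rewrite lee_fin; apply: ler_wpDl.
  exact: mulr_ge0.
have -> : 72 * L * d * (K * (12 * L * d / D)) = 864 * L ^+ 2 * K * (d ^+ 2 / D) by ring.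
by rewrite -[leRHS]mulrA; apply: ler_wpM2l C20 _ _ _; exact: quot_le2.
Qed.

Lemma hyperbolic_constant (len L l1 K : R) :
  0 < len -> 1 <= L -> 0 < l1 -> 0 < K ->
  exists C : R, forall (d D : R) (x : \bar R), 0 < d < 1 / 2 -> 0 <= D ->
    l1 * D <= 2 * L -> (x <= (288 * L * d)%:E)%E ->
    (d <= D -> 20 * d <= len -> forall n : nat,
      (x <= (72 * L * d * (K * (n.+1%:R * (12 * L * d / D)
                               + (2 ^+ n)^-1 ^+ 2)))%:E)%E) ->
    (x <= (C * (d ^+ 2 * `|ln d| / (d + D)))%:E)%E.
Proof.
move=> len0 L1 l10 K0; have L0 : 0 <= L by lra.
have l2 : 0 < ln 2 :> R by rewrite ln_gt0// ltr1n.
set T := 3 + 40 * L / (l1 * len).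
have T0 : 0 <= T.
  by apply: addr_ge0; [lra | apply: divr_ge0; [lra | apply: mulr_ge0; exact: ltW]].
set B := 36 * L + 2 * L / l1.
have B0 : 0 <= B by apply: addr_ge0; [lra | apply: divr_ge0; lra].
have L288 : 0 <= 288 * L by apply: mulr_ge0 L0; exact: ler0n.
have C10 : 0 <= 288 * L * T by exact: mulr_ge0.
have C20 : 0 <= 72 * L * K * B.
  by apply: mulr_ge0 B0; apply: mulr_ge0 (ltW K0); apply: mulr_ge0 L0; exact: ler0n.
exists ((288 * L * T + 72 * L * K * B * 2) / ln 2) => d D x d02 D0 hD h1 h2.
have [d0 d2] := andP d02.
have [n [n2d nl y1]] := dyadic_log d02.
set y := `|ln d| / ln 2 in nl y1; have y0 : 0 <= y by lra.
set q := d ^+ 2 / (d + D).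
have q0 : 0 <= q by apply: divr_ge0; [exact: sqr_ge0 | lra].
have -> : (288 * L * T + 72 * L * K * B * 2) / ln 2 * (d ^+ 2 * `|ln d| / (d + D)) =
    288 * L * T * q * y + 72 * L * K * B * 2 * q * y by rewrite /q /y; ring.
have [h|[dD dl]] := large_or_small len0 L1 l10 d0 hD.
  apply: (le_trans h1); rewrite lee_fin; apply: ler_wpDr.
    by apply: mulr_ge0 y0; apply: mulr_ge0 q0; apply: mulr_ge0 C20 _; exact: ler0n.
  apply: (@le_trans _ _ (288 * L * T * q)); last exact: ler_peMr (mulr_ge0 C10 q0) y1.
  by rewrite -[leRHS]mulrA; apply: ler_wpM2l L288 _ _ _; exact: quot_ge.
apply: (le_trans (h2 dD dl n)); rewrite lee_fin; apply: ler_wpDl.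
  exact: mulr_ge0 (mulr_ge0 C10 q0) y0.
have Dp : 0 < D by lra.
set x' := d / D; have x0 : 0 <= x' by apply: divr_ge0 => //; exact: ltW.
(* The square left after n halvings has area at most d^2 <= d = D x', and D is bounded, so it is
   absorbed in the main term. *)
have mb : n.+1%:R * (12 * L * d / D) + (2 ^+ n)^-1 ^+ 2 <= B * (y * x').
  have -> : B * (y * x') = 36 * L * (y * x') + 2 * L / l1 * (y * x') by rewrite /B; ring.
  apply: lerD.
    have -> : n.+1%:R * (12 * L * d / D) = n.+1%:R * (12 * L * x') by rewrite /x'; ring.
    have L12x : 0 <= 12 * L * x' by apply: mulr_ge0 => //; lra.
    by have := ler_wpM2r L12x nl; lra.
  have e1 : (2 ^+ n)^-1 ^+ 2 <= d.
    have e0 : 0 <= (2 ^+ n)^-1 :> R by rewrite invr_ge0 exprn_ge0.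
    rewrite expr2; apply: (@le_trans _ _ (d * 1)); last by rewrite mulr1.
    by apply: ler_pM => //; apply: (le_trans n2d); lra.
  apply: (le_trans e1).
  have dx : d = D * x' by rewrite /x' mulrC divfK// gt_eqF.
  have Dll : D <= 2 * L / l1 by rewrite ler_pdivlMr// mulrC.
  by rewrite {1}dx; apply: ler_pM => //; exact: ler_peMl.
apply: (@le_trans _ _ (72 * L * d * (K * (B * (y * x'))))).
  apply: ler_wpM2l; first by apply: mulr_ge0 (ltW d0); apply: mulr_ge0 L0; exact: ler0n.
  exact: ler_wpM2l (ltW K0) _ _ mb.
have -> : 72 * L * d * (K * (B * (y * x'))) = 72 * L * K * B * (d ^+ 2 / D) * y.
  by rewrite /x'; ring.
apply: ler_wpM2r y0 _ _ _; rewrite -[leRHS]mulrA; apply: ler_wpM2l C20 _ _ _.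
exact: quot_le2.
Qed.

(** Gathers what [elliptic_constant] and [hyperbolic_constant] consume; [K] is chosen before the
    intervals and [g]. *)
Lemma overlap_bound (len L m0 l1 kap : R) :
  0 < len -> 1 <= L -> 0 < m0 -> 0 < l1 -> 0 < kap ->
  exists2 K : R, 0 < K &
    forall (a0 a1 t0 t1 : R) (g : R -> R -> R) (sg : R),
    let A : set R := `[a0, a1]%classic in
    let I : set R := `[t0, t1]%classic in
    let I' : set R := `[t1 - (t1 - t0) / 2, t1]%classic in
    sg = 1 \/ sg = -1 -> t1 - t0 = len -> 1 <= t0 -> t1 <= 2 -> a0 <= a1 ->
    reg_finite A I g -> (forall a t, A a -> I t -> dt I g a t <> 0) ->
    (reg_norm A I g <= L%:E)%E -> (m0%:E <= inf_abs A I (dt I g))%E ->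
    (l1%:E <= lambda1 A I g)%E -> (kap%:E <= kappa A I g)%E ->
    (forall a a' t t', A a -> A a' -> I t -> I t' -> a' <> a -> t < t' ->
      0 < - sg * (cinematic_det I g a a' t t' * (dt I g a' t - dt I g a t)
                  * dt I g a t)) ->
    forall a a' d : R, A a -> A a' -> 0 < d < 1 ->
    [/\ l1 * `|a' - a| <= 2 * L,
        (sup_overlap g I' a a' d <= (288 * L * d)%:E)%E &
        d <= `|a' - a| -> 20 * d <= len ->
        (sg = -1 -> (sup_overlap g I' a a' d
           <= (72 * L * d * (K * (12 * L * d / `|a' - a|)))%:E)%E) /\
        (sg = 1 -> forall n : nat, (sup_overlap g I' a a' d
           <= (72 * L * d * (K * (n.+1%:R * (12 * L * d / `|a' - a|)
                                  + (2 ^+ n)^-1 ^+ 2)))%:E)%E)].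
Proof.
move=> len0 L1 m00 l10 kap0.
have L0 : 0 < L by lra.
have [cs cs0 [csa csb _ _]] : exists2 x : R, 0 < x &
    [/\ x <= kap / 2, x <= l1 * kap / (4 * L), x <= 1 & x <= 1].
  have L4 : 0 < 4 * L by lra.
  by apply: ex_le4 => //; [lra | apply: divr_gt0 => //; exact: mulr_gt0].
have kc : 2 * cs <= kap by lra.
have csL : 4 * L * cs <= l1 * kap.
  have L4 : 0 < 4 * L by lra.
  by move: csb; rewrite (ler_pdivlMr _ _ L4); lra.
have {csa csb} room0 : 0 < len / 4 by lra.
have [K K0 hK] := planar_area L1 m00 l10 cs0 kc room0.
exists K => // a0 a1 t0 t1 g sg A I I' sg1 tlen t0ge1 t1le2 a01.
move=> [dg dgt _] gn hreg hinf hlam hkap hs a a' d Aa Aa' d01.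
have [d0 d1] := andP d01.
have t01 : t0 < t1 by rewrite -subr_gt0 tlen.
have Aa0 : A a0 by rewrite /A /= in_itv /= lexx.
have It0 : I t0 by rewrite /I /= in_itv /= lexx ltW.
have It1 : I t1 by rewrite /I /= in_itv /= lexx ltW.
have ne01 : (a0, t0) <> (a0, t1) by case=> e; move: t01; rewrite e ltxx.
have [n1 n2 n3] := reg_normP Aa0 It0 Aa0 It1 ne01 hreg.
have gtL := sup_normP n1.
have gtLip := Lip_normP (ltW L0) n2; have gttLip := Lip_normP (ltW L0) n3.
have [ o o1 ho] := constant_sign a01 (ltW t01) gtLip gn.
have hm b t : A b -> I t -> m0 <= o * dt I g b t.
  by move=> Ab It; rewrite ho//; exact: inf_absP hinf _ _ Ab It.
have hl := lambda1P hlam; have hk := kappaP hkap.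
split.
- apply: (le_trans (hl a' a t1 Aa' Aa It1)); apply: (le_trans (ler_normB _ _)).
  by have := gtL a' t1 Aa' It1; have := gtL a t1 Aa It1; lra.
- exact: (overlap_trivial t01 t1le2 L1 dg gtL a Aa' d01).
move=> dD d20.
have ne : a' <> a.
  by move=> e; move: (lt_le_trans d0 dD); rewrite e subrr normr0 ltxx.
have pp := profile_of t0ge1 t1le2 L1 dg dgt gtL gtLip gttLip m00 l10 cs0 kc csL
    sg1 o1 hm hl hk hs Aa Aa' ne.
have e0 : 0 < 12 * L * d by rewrite mulr_gt0// mulr_gt0.
have d20' : 0 < 1 + 2 * d by lra.
have j1 : (t1 + d) / (1 + 2 * d) < t1.
  rewrite ltr_pdivrMr//; have := ler_wpM2r (ltW d0) (le_trans t0ge1 (ltW t01)); lra.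
(* Halving the interval leaves room len / 2 at its lower end, and 5 d takes at most half of that. *)
have j0 : t0 + len / 4 <= (t0 + t1) / 2 - 5 * d by lra.
have plan v ta := hK _ _ _ _ _ _ _ _ _ _ pp v _ _ ta _ e0 j1 j0.
have dl : 20 * d <= t1 - t0 by rewrite tlen.
have sub m := overlap_sublevel t01 t0ge1 t1le2 L1 dg gtL Aa Aa' o1 d01 dl (m := m).
have x0 : 0 <= 12 * L * d / `|a' - a| by apply: divr_ge0 => //; exact: ltW.
split=> sgE.
  apply: sub; first exact: mulr_ge0 (ltW K0) x0.
  by move=> v ta; apply: (plan v ta).1.
move=> n; apply: sub.
  apply: mulr_ge0 (ltW K0) _; apply: addr_ge0 (sqr_ge0 _).
  by apply: mulr_ge0 x0; exact: ler0n.
by move=> v ta; apply: (plan v ta).2.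
Qed.

(** The value [+oo] does occur: [lambda1] is an infimum over no pairs when [A] is a single point. *)
Lemma ex_pos_below (x : \bar R) : (0 < x)%E -> exists2 r : R, 0 < r & (r%:E <= x)%E.
Proof.
case: x => [r r0|_|//]; first by exists r.
by exists 1 => //; rewrite leey.
Qed.

End MainBound.

(** * Constants as functions of the prescribed quantities *)

Section Constants.
Context {R : realType}.
Implicit Types (g : R -> R -> R).

Definition admissible (len : R) (reg inf lam kap : \bar R) : Prop :=
  [/\ 0 < len, (reg < +oo)%E, (0 < inf)%E, (0 < lam)%E & (0 < kap)%E].

Lemma ex_real_above (x : \bar R) : (x < +oo)%E ->
  exists2 L : R, 1 <= L & (x <= L%:E)%E.
Proof.
case: x => [r _|//|_]; last by exists 1; rewrite ?leNye.
by exists (Num.max 1 r); rewrite ?lee_fin le_max lexx ?orbT.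
Qed.

(** Only the positivity of inf |g_t| takes an argument: nonvanishing becomes a lower bound by
    compactness. *)
Lemma nondegenerate_admissible (a0 a1 t0 t1 : R) g :
  let A : set R := `[a0, a1]%classic in
  let I : set R := `[t0, t1]%classic in
  a0 <= a1 -> t0 < t1 -> nondegenerate_away A I g -> cinematic A I g ->
  admissible (t1 - t0) (reg_norm A I g) (inf_abs A I (dt I g))
    (lambda1 A I g) (kappa A I g).
Proof.
move=> A I a01 t01 [[_ _ reg] gn lam] [_ kap].
split => //; first by rewrite subr_gt0.
have [L L1 hL] := ex_real_above reg.
have Aa0 : A a0 by rewrite /A /= in_itv /= lexx.
have It0 : I t0 by rewrite /I /= in_itv /= lexx ltW.
have It1 : I t1 by rewrite /I /= in_itv /= lexx ltW.
have ne : (a0, t0) <> (a0, t1) by case=> e; move: t01; rewrite e ltxx.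
have [_ n2 _] := reg_normP Aa0 It0 Aa0 It1 ne hL.
by apply: inf_abs_gt0 (ltW t01) (Lip_normP (le_trans ler01 L1) n2) gn.
Qed.

Lemma subset_itv12 (t0 t1 : R) : t0 < t1 ->
  `[t0, t1]%classic `<=` `[1, 2]%classic -> 1 <= t0 /\ t1 <= 2.
Proof.
move=> t01 sub.
have /sub : `[t0, t1]%classic t0 by rewrite /= in_itv /= lexx ltW.
have /sub : `[t0, t1]%classic t1 by rewrite /= in_itv /= lexx ltW.
by rewrite /= !in_itv /= => /andP[_ ->] /andP[->].
Qed.

Lemma elliptic_overlap (len : R) (reg inf lam kap : \bar R) :
  exists C : R, forall (a0 a1 t0 t1 : R) g,
    let A : set R := `[a0, a1]%classic in
    let I : set R := `[t0, t1]%classic in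
    let I' : set R := `[t1 - (t1 - t0) / 2, t1]%classic in
    a0 <= a1 -> t0 < t1 -> I `<=` `[1, 2]%classic ->
    nondegenerate_away A I g -> cinematic A I g -> elliptic A I g ->
    t1 - t0 = len -> reg_norm A I g = reg -> inf_abs A I (dt I g) = inf ->
    lambda1 A I g = lam -> kappa A I g = kap ->
    forall a a' : R, A a -> A a' -> forall d : R, 0 < d < 1 ->
    (sup_overlap g I' a a' d <= (C * (d ^+ 2 / (d + `|a' - a|)))%:E)%E.
Proof.
have [[len0 reg0 inf0 lam0 kap0]|nadm] := pselect (admissible len reg inf lam kap); last first.
  (* Values that are not admissible come from no such [g], so any constant serves. *)
  exists 0 => a0 a1 t0 t1 g A I I' a01 t01 _ nd cin _ e1 e2 e3 e4 e5.
  by case: nadm; rewrite -e1 -e2 -e3 -e4 -e5; exact: nondegenerate_admissible.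
have [L L1 hL] := ex_real_above reg0.
have [m0 m00 hm] := ex_pos_below inf0; have [l1 l10 hl] := ex_pos_below lam0.
have [k k0 hk] := ex_pos_below kap0.
have [K K0 hK] := overlap_bound len0 L1 m00 l10 k0.
have [C hC] := elliptic_constant len0 L1 l10 K0.
exists C => a0 a1 t0 t1 g A I I' a01 t01 I12 [rf gn _] _ ell e1 e2 e3 e4 e5.
move=> a a' Aa Aa' d d01; have [t0ge1 t1le2] := subset_itv12 t01 I12.
rewrite -e2 -/A -/I in hL; rewrite -e3 -/A -/I in hm; rewrite -e4 -/A -/I in hl; rewrite -e5 -/A -/I in hk.
have hs b b' t t' : A b -> A b' -> I t -> I t' -> b' <> b -> t < t' ->
    0 < - (-1) * (cinematic_det I g b b' t t' * (dt I g b' t - dt I g b t) * dt I g b t).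
  by move=> *; rewrite opprK mul1r; exact: ell.
have [h1 h2 h3] := hK a0 a1 t0 t1 g (-1) (or_intror erefl) e1 t0ge1 t1le2 a01 rf gn hL hm hl hk hs a a' d Aa Aa' d01.
have [d0 _] := andP d01.
apply: hC => // dD dl; exact: (h3 dD dl).1.
Qed.

Lemma hyperbolic_overlap (len : R) (reg inf lam kap : \bar R) :
  exists C : R, forall (a0 a1 t0 t1 : R) g,
    let A : set R := `[a0, a1]%classic in
    let I : set R := `[t0, t1]%classic in
    let I' : set R := `[t1 - (t1 - t0) / 2, t1]%classic in
    a0 <= a1 -> t0 < t1 -> I `<=` `[1, 2]%classic ->
    nondegenerate_away A I g -> cinematic A I g -> hyperbolic A I g ->
    t1 - t0 = len -> reg_norm A I g = reg -> inf_abs A I (dt I g) = inf ->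
    lambda1 A I g = lam -> kappa A I g = kap ->
    forall a a' : R, A a -> A a' -> forall d : R, 0 < d < 1 / 2 ->
    (sup_overlap g I' a a' d <= (C * (d ^+ 2 * `|ln d| / (d + `|a' - a|)))%:E)%E.
Proof.
have [[len0 reg0 inf0 lam0 kap0]|nadm] := pselect (admissible len reg inf lam kap); last first.
  exists 0 => a0 a1 t0 t1 g A I I' a01 t01 _ nd cin _ e1 e2 e3 e4 e5.
  by case: nadm; rewrite -e1 -e2 -e3 -e4 -e5; exact: nondegenerate_admissible.
have [L L1 hL] := ex_real_above reg0.
have [m0 m00 hm] := ex_pos_below inf0; have [l1 l10 hl] := ex_pos_below lam0.
have [k k0 hk] := ex_pos_below kap0.
have [K K0 hK] := overlap_bound len0 L1 m00 l10 k0.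
have [C hC] := hyperbolic_constant len0 L1 l10 K0.
exists C => a0 a1 t0 t1 g A I I' a01 t01 I12 [rf gn _] _ hyp e1 e2 e3 e4 e5.
move=> a a' Aa Aa' d d02; have [t0ge1 t1le2] := subset_itv12 t01 I12.
rewrite -e2 -/A -/I in hL; rewrite -e3 -/A -/I in hm; rewrite -e4 -/A -/I in hl; rewrite -e5 -/A -/I in hk.
have hs b b' t t' : A b -> A b' -> I t -> I t' -> b' <> b -> t < t' ->
    0 < - 1 * (cinematic_det I g b b' t t' * (dt I g b' t - dt I g b t) * dt I g b t).
  by move=> *; rewrite mulN1r oppr_gt0; exact: hyp.
have d01 : 0 < d < 1 by case/andP: d02 => -> ?; lra.
have [h1 h2 h3] := hK a0 a1 t0 t1 g 1 (or_introl erefl) e1 t0ge1 t1le2 a01 rf gn hL hm hl hk hs a a' d Aa Aa' d01.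
apply: hC => // dD dl n; exact: (h3 dD dl).2.
Qed.

End Constants.

Theorem theorem1p5 (R : realType) :
  (exists C : R -> \bar R -> \bar R -> \bar R -> \bar R -> R,
    forall (a0 a1 t0 t1 : R) (g : R -> R -> R),
      let A : set R := `[a0, a1]%classic in
      let I : set R := `[t0, t1]%classic in
      let I' : set R := `[t1 - (t1 - t0) / 2, t1]%classic in
      a0 <= a1 -> t0 < t1 -> I `<=` `[1, 2]%classic ->
      nondegenerate_away A I g -> cinematic A I g -> elliptic A I g ->
      forall a a' : R, A a -> A a' ->
      forall d : R, 0 < d < 1 ->
      (sup_overlap g I' a a' d <=
        (C (t1 - t0) (reg_norm A I g) (inf_abs A I (dt I g))
           (lambda1 A I g) (kappa A I g)
         * (d ^+ 2 / (d + `|a' - a|)))%:E)%E)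
  /\
  (exists C : R -> \bar R -> \bar R -> \bar R -> \bar R -> (R -> \bar R) -> R,
    forall (a0 a1 t0 t1 : R) (g : R -> R -> R),
      let A : set R := `[a0, a1]%classic in
      let I : set R := `[t0, t1]%classic in
      let I' : set R := `[t1 - (t1 - t0) / 2, t1]%classic in
      a0 <= a1 -> t0 < t1 -> I `<=` `[1, 2]%classic ->
      nondegenerate_away A I g -> cinematic A I g -> hyperbolic A I g ->
      has_third A I g -> third_equicontinuous A I g ->
      forall a a' : R, A a -> A a' ->
      forall d : R, 0 < d < 1 / 2 ->
      (sup_overlap g I' a a' d <=
        (C (t1 - t0) (reg_norm A I g) (inf_abs A I (dt I g))
           (lambda1 A I g) (kappa A I g) (third_modulus A I g)
         * (d ^+ 2 * `|ln d| / (d + `|a' - a|)))%:E)%E).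
Proof.
split.
  (* Choice turns a constant for each tuple of values into a function of the tuple. *)
  have /choice[C hC] := fun x : R * \bar R * \bar R * \bar R * \bar R =>
    elliptic_overlap x.1.1.1.1 x.1.1.1.2 x.1.1.2 x.1.2 x.2.
  exists (fun len reg inf lam kap => C (len, reg, inf, lam, kap)).
  move=> a0 a1 t0 t1 g A I I' a01 t01 I12 nd cin ell.
  exact: (hC (t1 - t0, reg_norm A I g, inf_abs A I (dt I g), lambda1 A I g,
    kappa A I g) a0 a1 t0 t1 g a01 t01 I12 nd cin ell).
have /choice[C hC] := fun x : R * \bar R * \bar R * \bar R * \bar R =>
  hyperbolic_overlap x.1.1.1.1 x.1.1.1.2 x.1.1.2 x.1.2 x.2.
exists (fun len reg inf lam kap _ => C (len, reg, inf, lam, kap)).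
move=> a0 a1 t0 t1 g A I I' a01 t01 I12 nd cin hyp _ _.
exact: (hC (t1 - t0, reg_norm A I g, inf_abs A I (dt I g), lambda1 A I g,
  kappa A I g) a0 a1 t0 t1 g a01 t01 I12 nd cin hyp).
Qed.
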